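(* Let $W, Z\subseteq\omega$ be such that $W\not\leq_T Z$. Then every $2$-bounded coloring $f:[\omega]^2\to\omega$ (of arbitrary complexity) admits an infinite $f$-rainbow $H\subseteq\omega$ such that $W\not\leq_T H\oplus Z$.
   Context: $[X]^2$ denotes the set of $2$-element subsets of $X$, identified with increasing pairs. A function $f:[\omega]^2\to\omega$ is $2$-bounded if $|f^{-1}(c)|\le 2$ for every $c\in\omega$. A set $X\subseteq\omega$ is an $f$-rainbow if $f$ restricted to $[X]^2$ is injective. $\leq_T$ is Turing reducibility and $A\oplus B$ is the Turing join. *)

(* Defs.v *)
From Stdlib Require Cantor.
From mathcomp Require Import all_boot.
From mathcomp Require Import boolp classical_sets functions cardinality.

Set Implicit Arguments.
Unset Strict Implicit.
Unset Printing Implicit Defensive.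

Local Open Scope classical_set_scope.
Local Open Scope card_scope.

(* Codes for the unary partial functions on nat that are partial recursive
   relative to an oracle; several arguments are packed with the Cantor pairing
   [Cantor.to_nat], which is a bijection. *)
Inductive code : Type :=
  | Zero
  | Succ
  | Fst
  | Snd
  | Oracle
  | Pair of code & code
  | Comp of code & code
  | Prec of code & code
  | Mu of code.

(* [eval Z c x y] means that [c] with oracle [Z] converges on input [x] with
   output [y].  In the clause for [Oracle], [n \in Z] is the classical
   membership boolean, coerced to 0 or 1.  The function [h] in the clause for
   [Mu] witnesses that the computations below the returned value converge to
   nonzero values, as unbounded search requires. *)
Inductive eval (Z : set nat) : code -> nat -> nat -> Prop :=
  | eval_zero x : eval Z Zero x 0
  | eval_succ x : eval Z Succ x x.+1
  | eval_fst a b : eval Z Fst (Cantor.to_nat (a, b)) a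
  | eval_snd a b : eval Z Snd (Cantor.to_nat (a, b)) b
  | eval_oracle n : eval Z Oracle n (n \in Z)
  | eval_pair c d x a b :
      eval Z c x a -> eval Z d x b ->
      eval Z (Pair c d) x (Cantor.to_nat (a, b))
  | eval_comp c d x y z :
      eval Z d x y -> eval Z c y z -> eval Z (Comp c d) x z
  | eval_prec0 c d a y :
      eval Z c a y -> eval Z (Prec c d) (Cantor.to_nat (a, 0)) y
  | eval_precS c d a n y z :
      eval Z (Prec c d) (Cantor.to_nat (a, n)) y ->
      eval Z d (Cantor.to_nat (a, Cantor.to_nat (n, y))) z ->
      eval Z (Prec c d) (Cantor.to_nat (a, n.+1)) z
  | eval_mu c a n (h : nat -> nat) :
      (forall m, m < n -> eval Z c (Cantor.to_nat (a, m)) (h m).+1) ->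
      eval Z c (Cantor.to_nat (a, n)) 0 ->
      eval Z (Mu c) a n.

Definition turing_reducible (A B : set nat) : Prop :=
  exists c : code, forall n : nat, eval B c n (n \in A).

Definition turing_join (A B : set nat) : set nat :=
  [set n.*2 | n in A] `|` [set n.*2.+1 | n in B].

Definition increasing_pairs (X : set nat) : set (nat * nat) :=
  [set p | [/\ X p.1, X p.2 & p.1 < p.2]].

(* A coloring of the 2-element subsets of nat is represented by a function on
   all pairs, of which only the values at increasing pairs matter. *)
Definition two_bounded (f : nat * nat -> nat) : Prop :=
  forall c : nat, increasing_pairs setT `&` f @^-1` [set c] #<= `I_2.

Definition rainbow (f : nat * nat -> nat) (X : set nat) : Prop :=
  set_inj (increasing_pairs X) f.

(* Main.v *)
Require Import Defs.
From mathcomp Require Import all_boot.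
From mathcomp Require Import boolp classical_sets functions cardinality.
From mathcomp Require Import zify.

Set Implicit Arguments.
Unset Strict Implicit.
Unset Printing Implicit Defensive.

Local Open Scope classical_set_scope.

(** The colouring is replaced by its matching: two pairs are linked when they
    are distinct and have the same colour, and two-boundedness says that a pair
    has at most one partner.  The rainbow is built by Mathias forcing, with
    conditions consisting of a finite set [F] and an infinite reservoir [X] that
    does not compute [W] together with [Z], such that adding any one point of
    [X] to [F] creates no linked pairs.

    Fix a functional to be diagonalised.  The real matching [M] is of arbitrary
    complexity, so one asks instead about all possible matchings at once: does
    every matching, of pairs and of points, that is compatible with the condition
    admit a finite set between [F] and [F] together with [X] that is free for it
    and on which the functional gives the answer [i] at [n]?  By compactness of Cantor space this question is
    enumerable in [X] and [Z] ([enumerable_forall]).  If for each [n] the only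
    answer found were the value of [W] at [n], then [X] and [Z] would compute
    [W].  So there are two cases ([forcing_question]).

    A wrong answer is found at some [n].  It is then found for [M] together with
    the matching of points obtained as the limit of the links between [(a, y)]
    and [(c, y)] as [y] runs through ever thinner cone avoiding reservoirs.
    Freeness for this limit is what allows a finite set to be extended by an
    infinite reservoir again ([limit_matching]).  The reservoirs come from the
    strong cone avoidance of the infinite pigeonhole principle, proved by
    Dzhafarov and Jockusch, here [pigeonhole_avoiding].

    Otherwise some matching misses the right answer at some [n], and by the cone
    avoidance basis theorem ([cone_avoidance_basis]) it can be chosen so that
    together with [X] and [Z] it does not compute [W].  A reservoir that is free
    for it forces the functional to miss the right answer as well.  Such a
    reservoir is obtained by running the same forcing with this matching as [M]
    and as part of the oracle ([rainbow_below]).  Then the question ranges only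
    over matchings of points, and a free set for a matching of points is found
    effectively, by keeping the smaller of two linked points
    ([point_free_thinning]). *)

(** * Functions computable uniformly in a family of oracles *)

Local Notation "⟪ a , b ⟫" := (Cantor.to_nat (@pair nat nat a b))
  (format "⟪ a ,  b ⟫").

#[local] Arguments Cantor.to_nat : simpl never.

Definition pi1 (x : nat) : nat := (Cantor.of_nat x).1.
Definition pi2 (x : nat) : nat := (Cantor.of_nat x).2.

Lemma pairK1 a b : pi1 ⟪a, b⟫ = a.
Proof. by rewrite /pi1 Cantor.cancel_of_to. Qed.

Lemma pairK2 a b : pi2 ⟪a, b⟫ = b.
Proof. by rewrite /pi2 Cantor.cancel_of_to. Qed.

Lemma pairE x : ⟪pi1 x, pi2 x⟫ = x.
Proof. by rewrite /pi1 /pi2 -surjective_pairing Cantor.cancel_to_of. Qed.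

Lemma pair_inj a b c d : ⟪a, b⟫ = ⟪c, d⟫ -> a = c /\ b = d.
Proof. by move=> /Cantor.to_nat_inj[-> ->]. Qed.

Lemma leq_pair a b : a + b <= ⟪a, b⟫.
Proof. by have := Cantor.to_nat_non_decreasing a b; lia. Qed.

Section Closure.
Variables (I : Type) (O : I -> set nat).

(** One code serves all the oracles of the family; this uniformity is what
    lets a statement about all oracles be settled by a search. *)
Definition computable (g : I -> nat -> nat) : Prop :=
  exists c, forall i x, eval (O i) c x (g i x).

Definition recursive (P : I -> nat -> bool) : Prop :=
  computable (fun i x => P i x).

Definition uniformly_below (A : I -> set nat) : Prop :=
  recursive (fun i x => x \in A i).

Lemma computable_ext g h :
  (forall i x, g i x = h i x) -> computable g -> computable h.
Proof. by move=> gh [c cP]; exists c => i x; rewrite -gh. Qed.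

Lemma computable_comp h g : computable h -> computable g ->
  computable (fun i x => h i (g i x)).
Proof.
move=> [c cP] [d dP]; exists (Comp c d) => i x.
exact: eval_comp (dP i x) (cP i _).
Qed.

Lemma computable_pair g h : computable g -> computable h ->
  computable (fun i x => ⟪g i x, h i x⟫).
Proof.
move=> [c cP] [d dP]; exists (Pair c d) => i x.
exact: eval_pair (cP i x) (dP i x).
Qed.

Lemma computable_pi1 g : computable g -> computable (fun i x => pi1 (g i x)).
Proof.
apply: (@computable_comp (fun _ => pi1)); exists Fst => i x.
by rewrite -[x in eval _ _ x]pairE; apply: eval_fst.
Qed.

Lemma computable_pi2 g : computable g -> computable (fun i x => pi2 (g i x)).
Proof.
apply: (@computable_comp (fun _ => pi2)); exists Snd => i x.
by rewrite -[x in eval _ _ x]pairE; apply: eval_snd.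
Qed.

Lemma computable_id : computable (fun _ x => x).
Proof.
exists (Pair Fst Snd) => i x; rewrite -[x]pairE.
by apply: eval_pair; [apply: eval_fst|apply: eval_snd].
Qed.

Lemma computable_succ g : computable g -> computable (fun i x => (g i x).+1).
Proof.
by apply: (@computable_comp (fun _ => S)); exists Succ => i x; apply: eval_succ.
Qed.

Lemma computable_cst n : computable (fun _ _ => n).
Proof.
elim: n => [|n IHn]; first by exists Zero => i x; apply: eval_zero.
exact: computable_succ.
Qed.

Lemma recursive_oracle g : computable g -> recursive (fun i x => g i x \in O i).
Proof.
apply: (@computable_comp (fun i x => (x \in O i) : nat)).
by exists Oracle => i x; apply: eval_oracle.
Qed.

Lemma computable_iteri n f b :
  computable (fun i z => f i (pi1 z) (pi1 (pi2 z)) (pi2 (pi2 z))) ->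
  computable b -> computable n ->
  computable (fun i x => iteri (n i x) (f i x) (b i x)).
Proof.
move=> [d dP] [c cP] ncomp.
have pcomp : computable (fun i z => iteri (pi2 z) (f i (pi1 z)) (b i (pi1 z))).
  exists (Prec c d) => i x; rewrite -[x in eval _ _ x]pairE.
  elim: (pi2 x) => [|k IHk] /=; first exact: eval_prec0.
  apply: eval_precS IHk _.
  by move: (dP i ⟪pi1 x, ⟪k, iteri k (f i (pi1 x)) (b i (pi1 x))⟫⟫);
     rewrite pairK1 !pairK2 pairK1.
apply: computable_ext
  (computable_comp pcomp (computable_pair computable_id ncomp)) => i x.
by rewrite pairK1 pairK2.
Qed.

Lemma computable_if P g h : recursive P -> computable g -> computable h ->
  computable (fun i x => if P i x then g i x else h i x).
Proof.
move=> Pc gc hc.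
have : computable (fun i x => iteri (P i x) (fun _ _ => g i x) (h i x)).
  apply: computable_iteri hc Pc.
  exact: (computable_comp gc (computable_pi1 computable_id)).
by apply: computable_ext => i x; case: (P i x).
Qed.

Lemma computable_pred g : computable g -> computable (fun i x => (g i x).-1).
Proof.
move=> gc; apply: computable_ext
    (computable_iteri (f := fun _ _ k _ => k) _ (computable_cst 0) gc).
  by move=> i x; case: (g i x).
exact: computable_pi1 (computable_pi2 computable_id).
Qed.

Lemma computable_sub g h : computable g -> computable h ->
  computable (fun i x => g i x - h i x).
Proof.
move=> gc hc; apply: computable_ext
    (computable_iteri (f := fun _ _ _ y => y.-1) _ gc hc).
  by move=> i x; elim: (h i x) => [|k /= ->]; rewrite ?subn0 ?subnS.
exact: computable_pred (computable_pi2 (computable_pi2 computable_id)).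
Qed.

Lemma recursive_leq0 g : computable g -> recursive (fun i x => g i x == 0).
Proof.
move=> gc; apply: computable_ext
    (computable_iteri (f := fun _ _ _ _ => 0) _ (computable_cst 1) gc).
  by move=> i x; case: (g i x).
exact: computable_cst.
Qed.

Lemma recursive_leq g h : computable g -> computable h ->
  recursive (fun i x => g i x <= h i x).
Proof. by move=> gc hc; exact: recursive_leq0 (computable_sub gc hc). Qed.

Lemma recursive_negb P : recursive P -> recursive (fun i x => ~~ P i x).
Proof.
by move=> Pc; apply: computable_ext (recursive_leq0 Pc) => i x; case: (P i x).
Qed.

Lemma recursive_and P Q : recursive P -> recursive Q ->
  recursive (fun i x => P i x && Q i x).
Proof.
move=> Pc Qc; apply: computable_ext (computable_if Pc Qc (computable_cst 0)).
by move=> i x; case: (P i x).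
Qed.

Lemma recursive_or P Q : recursive P -> recursive Q ->
  recursive (fun i x => P i x || Q i x).
Proof.
move=> Pc Qc; apply: computable_ext (computable_if Pc (computable_cst 1) Qc).
by move=> i x; case: (P i x).
Qed.

Lemma recursive_implb P Q : recursive P -> recursive Q ->
  recursive (fun i x => P i x ==> Q i x).
Proof.
move=> Pc Qc; apply: computable_ext (computable_if Pc Qc (computable_cst 1)).
by move=> i x; case: (P i x).
Qed.

Lemma recursive_eq g h : computable g -> computable h ->
  recursive (fun i x => g i x == h i x).
Proof.
move=> gc hc; apply: computable_ext
  (recursive_and (recursive_leq gc hc) (recursive_leq hc gc)) => i x.
by rewrite -eqn_leq.
Qed.

(** Unbounded search, for a search that always succeeds. *)
Lemma computable_min P g :
  recursive (fun i z => P i (pi1 z) (pi2 z)) ->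
  (forall i x, P i x (g i x)) -> (forall i x m, P i x m -> g i x <= m) ->
  computable g.
Proof.
move=> /recursive_negb[c cP] gP gmin; exists (Mu c) => i x.
apply: (@eval_mu _ _ _ _ (fun=> 0)) => [m mg|].
  suff -> : 1 = ~~ P i x m by move: (cP i ⟪x, m⟫); rewrite pairK1 pairK2.
  by case: (boolP (P i x m)) => // /gmin; lia.
by move: (cP i ⟪x, g i x⟫); rewrite pairK1 pairK2 gP.
Qed.

(** A bounded search is an unbounded one that the bound also stops; bounded
    quantifiers then compare its result with the bound. *)
Lemma computable_find P b :
  recursive (fun i z => P i (pi1 z) (pi2 z)) -> computable b ->
  computable (fun i x => find (P i x) (iota 0 (b i x))).
Proof.
move=> Pc bc.
apply: (@computable_min (fun i x m => P i x m || (b i x <= m))).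
- apply: recursive_or Pc (recursive_leq _ (computable_pi2 computable_id)).
  exact: computable_comp bc (computable_pi1 computable_id).
- move=> i x; set s := iota _ _.
  case: (boolP (has (P i x) s)) => [Ps|]; last first.
    by rewrite has_find size_iota -leqNgt => ->; rewrite orbT.
  move: (nth_find 0 Ps); rewrite nth_iota ?add0n => [->//|].
  by rewrite has_find size_iota in Ps.
- move=> i x m; have := find_size (P i x) (iota 0 (b i x)); rewrite size_iota.
  case: (ltnP m (b i x)) => [mb _|bm fb _]; last exact: leq_trans fb bm.
  rewrite orbF => Pm; rewrite leqNgt; apply/negP => mf.
  by have := before_find 0 mf; rewrite nth_iota // Pm.
Qed.

Lemma recursive_all P b :
  recursive (fun i z => P i (pi1 z) (pi2 z)) -> computable b ->
  recursive (fun i x => all (P i x) (iota 0 (b i x))).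
Proof.
move=> Pc bc; have := recursive_leq bc
  (computable_find (P := fun i x m => ~~ P i x m) (recursive_negb Pc) bc).
apply: computable_ext => i x.
by rewrite -[all _ _]negbK -has_predC has_find size_iota -leqNgt.
Qed.

Lemma recursive_has P b :
  recursive (fun i z => P i (pi1 z) (pi2 z)) -> computable b ->
  recursive (fun i x => has (P i x) (iota 0 (b i x))).
Proof.
move=> Pc bc.
have := recursive_negb (recursive_leq bc (computable_find Pc bc)).
by apply: computable_ext => i x; rewrite has_find size_iota -ltnNge.
Qed.

Lemma recursive_odd g : computable g -> recursive (fun i x => odd (g i x)).
Proof.
move=> gc; apply: computable_ext
    (computable_iteri (f := fun _ _ _ y => y == 0) _ (computable_cst 0) gc).
  by move=> i x; elim: (g i x) => [|k /= ->] //; case: (odd k).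
exact: recursive_leq0 (computable_pi2 (computable_pi2 computable_id)).
Qed.

Lemma computable_half g : computable g -> computable (fun i x => (g i x)./2).
Proof.
move=> gc.
have f1 : computable (fun i z => iteri (pi1 z) (fun k y =>
    if odd k then y.+1 else y) 0).
  apply: computable_iteri (computable_cst 0) (computable_pi1 computable_id).
  set k := fun z => pi1 (pi2 z); set y := fun z => pi2 (pi2 z).
  have yc : computable (fun _ => y).
    exact: computable_pi2 (computable_pi2 computable_id).
  apply: computable_if (computable_succ yc) yc.
  exact: recursive_odd (computable_pi1 (computable_pi2 computable_id)).
apply: computable_ext
  (computable_comp f1 (computable_pair gc (computable_cst 0))) => i x.
rewrite pairK1; elim: (g i x) => //= k ->; rewrite uphalf_half.
by case: (odd k).
Qed.

(** A number serves as the canonical index of the finite set of the positions of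
    its nonzero binary digits. *)
Definition bit (u k : nat) : bool := odd (iter k half u).

Lemma recursive_bit g h : computable g -> computable h ->
  recursive (fun i x => bit (g i x) (h i x)).
Proof.
move=> gc hc; apply: recursive_odd.
apply: computable_ext
    (computable_iteri (f := fun _ _ _ y => y./2) _ gc hc).
  by move=> i x; elim: (h i x) => //= k ->.
exact: computable_half (computable_pi2 (computable_pi2 computable_id)).
Qed.

Lemma recursive_mem A g : uniformly_below A -> computable g ->
  recursive (fun i x => g i x \in A i).
Proof. exact: (@computable_comp (fun i x => (x \in A i) : nat)). Qed.

End Closure.


Ltac computability_step :=
  match goal with
  | _ => assumption
  | H : computable ?O ?s |- computable ?O (fun i z => ?s i (@?g i z)) =>
      refine (computable_comp (h := s) (g := g) H _)
  | H : recursive ?O ?s |- recursive ?O (fun i z => ?s i (@?g i z)) =>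
      refine (computable_comp (h := fun i z => nat_of_bool (s i z)) (g := g) H _)
  | |- recursive _ (fun i z => andb (@?P i z) (@?Q i z)) => apply: recursive_and
  | |- recursive _ (fun i z => orb (@?P i z) (@?Q i z)) => apply: recursive_or
  | |- recursive _ (fun i z => implb (@?P i z) (@?Q i z)) =>
      apply: recursive_implb
  | |- recursive _ (fun i z => negb (@?P i z)) => apply: recursive_negb
  | |- recursive _ (fun i z => bit (@?P i z) (@?Q i z)) => apply: recursive_bit
  | |- recursive _ (fun i z => @?P i z == @?Q i z) => apply: recursive_eq
  | |- recursive _ (fun i z => leq (@?P i z) (@?Q i z)) => apply: recursive_leq
  | |- recursive _ (fun i z => odd (@?P i z)) => apply: recursive_odd
  | |- recursive _ (fun i z => all (@?P i z) (iota 0 (@?b i z))) =>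
      apply: recursive_all; cbv beta
  | |- recursive _ (fun i z => has (@?P i z) (iota 0 (@?b i z))) =>
      apply: recursive_has; cbv beta
  | H : forall e k, computable ?O e -> computable ?O k -> recursive ?O _
    |- recursive ?O _ => apply: H
  | H : forall e s x, computable ?O e -> computable ?O s -> computable ?O x ->
      computable ?O _ |- computable ?O _ => apply: H
  | |- recursive _ (fun i z => (@?g i z) \in (@?A i z)) =>
      apply: recursive_mem
  | |- computable _ (fun i z => nat_of_bool (@?P i z)) => change (recursive _ P)
  | |- computable _ _ => first
    [ apply: computable_id | apply: computable_cst
    | apply: computable_if | apply: computable_iteri; cbv beta
    | apply: computable_find; cbv beta
    | apply: computable_pred | apply: computable_succ | apply: computable_pair
    | apply: computable_sub
    | apply: computable_half | apply: computable_pi1 | apply: computable_pi2 ]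
  end.

Ltac computability := cbv beta; repeat computability_step.

Lemma computable_reindex (I J : Type) (O : I -> set nat) g (h : J -> I) :
  computable O g -> computable (fun j => O (h j)) (fun j => g (h j)).
Proof. by move=> [c cP]; exists c => j x; apply: cP. Qed.

(** Oracle questions are replaced by runs of the program that answers them. *)
Lemma computable_trans (I : Type) (O A : I -> set nat) g :
  uniformly_below O A -> computable A g -> computable O g.
Proof.
move=> [d dP] [c cP].
pose fix subst (c : code) : code := match c with
  | Oracle => d
  | Pair c1 c2 => Pair (subst c1) (subst c2)
  | Comp c1 c2 => Comp (subst c1) (subst c2)
  | Prec c1 c2 => Prec (subst c1) (subst c2)
  | Mu c1 => Mu (subst c1)
  | c => c
  end.
exists (subst c) => i x; elim: (cP i x) => //= {c cP x}.
- exact: eval_zero.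
- exact: eval_succ.
- exact: eval_fst.
- exact: eval_snd.
- by move=> c1 c2 x a b _ IH1 _ IH2; apply: eval_pair.
- by move=> c1 c2 x y z _ IH1 _ IH2; apply: eval_comp IH1 IH2.
- by move=> c1 c2 a y _ IH; apply: eval_prec0.
- by move=> c1 c2 a n y z _ IH1 _ IH2; apply: eval_precS IH1 IH2.
- by move=> c a n h _ IH1 _ IH2; apply: eval_mu IH2; apply: IH1.
Qed.

Lemma turing_reducibleE (A B : set nat) :
  turing_reducible A B <-> uniformly_below (fun _ : unit => B) (fun=> A).
Proof. by split=> [[c cP]|[c cP]]; exists c => // n; apply: (cP tt). Qed.

Lemma uniformly_below_trans (I : Type) (O : I -> set nat) (A B : set nat) :
  turing_reducible A B -> uniformly_below O (fun=> B) ->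
  uniformly_below O (fun=> A).
Proof.
move=> /turing_reducibleE AB OB; apply: computable_trans OB _.
exact: (computable_reindex (fun _ : I => tt) AB).
Qed.

Lemma turing_trans (A B C : set nat) :
  turing_reducible A B -> turing_reducible B C -> turing_reducible A C.
Proof.
rewrite !turing_reducibleE => AB BC.
by apply: uniformly_below_trans BC; apply/turing_reducibleE.
Qed.

Lemma in_join (A B : set nat) k :
  (k \in turing_join A B) = if odd k then k./2 \in B else k./2 \in A.
Proof.
have kE := odd_double_half k; apply/idP/idP.
  rewrite inE => -[[n An]|[n Bn]] <-.
    by rewrite odd_double doubleK inE.
  by rewrite /= odd_double /= uphalf_double inE.
rewrite inE; case: (odd k) kE => /= kE; rewrite inE => kH.
  by right; exists k./2.
by left; exists k./2.
Qed.

Section Joins.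
Variable I : Type.
Implicit Types O A B : I -> set nat.

Lemma recursive_join O (A B : I -> nat -> set nat) k : computable O k ->
  recursive O (fun i x => (k i x)./2 \in A i x) ->
  recursive O (fun i x => (k i x)./2 \in B i x) ->
  recursive O (fun i x => k i x \in turing_join (A i x) (B i x)).
Proof.
move=> kc Ac Bc; apply: computable_ext
  (computable_if (recursive_odd kc) Bc Ac) => i x.
by rewrite in_join; case: ifP.
Qed.

Lemma uniformly_below_join O A B : uniformly_below O A -> uniformly_below O B ->
  uniformly_below O (fun i => turing_join (A i) (B i)).
Proof.
move=> Ac Bc; apply: recursive_join; first by computability.
  by apply: (recursive_mem Ac); computability.
by apply: (recursive_mem Bc); computability.
Qed.

Lemma uniformly_below_joinl A B :
  uniformly_below (fun i => turing_join (A i) (B i)) A.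
Proof.
have : recursive (fun i => turing_join (A i) (B i))
    (fun i x => iteri x (fun _ y => y.+2) 0 \in turing_join (A i) (B i)).
  by apply: recursive_oracle; computability.
apply: computable_ext => i x.
suff -> : iteri x (fun _ y => y.+2) 0 = x.*2 by rewrite in_join odd_double doubleK.
by elim: x => //= x ->; rewrite doubleS.
Qed.

Lemma uniformly_below_joinr A B :
  uniformly_below (fun i => turing_join (A i) (B i)) B.
Proof.
have : recursive (fun i => turing_join (A i) (B i))
    (fun i x => (iteri x (fun _ y => y.+2) 0).+1 \in turing_join (A i) (B i)).
  by apply: recursive_oracle; computability.
apply: computable_ext => i x.
suff -> : iteri x (fun _ y => y.+2) 0 = x.*2.
  by rewrite in_join /= odd_double /= uphalf_double.
by elim: x => //= x ->; rewrite doubleS.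
Qed.

End Joins.

(** * Evaluation with bounded resources *)

(** Evaluation with the bound [s] on searches and on oracle questions, where [0]
    stands for no answer and [y.+1] for the answer [y].  Nothing else needs a
    bound, so that the function is defined by recursion on the code and is
    computable without a universal machine. *)
Fixpoint evn (Z : set nat) (c : code) (s x : nat) : nat :=
  match c with
  | Zero => 1
  | Succ => x.+2
  | Fst => (pi1 x).+1
  | Snd => (pi2 x).+1
  | Oracle => if s <= x then 0 else if x \in Z then 2 else 1
  | Pair c d =>
      if evn Z c s x == 0 then 0 else
      if evn Z d s x == 0 then 0 else
      ⟪(evn Z c s x).-1, (evn Z d s x).-1⟫.+1
  | Comp c d =>
      if evn Z d s x == 0 then 0 else evn Z c s (evn Z d s x).-1
  | Prec c d =>
      iteri (pi2 x) (fun k r =>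
          if r == 0 then 0 else evn Z d s ⟪pi1 x, ⟪k, r.-1⟫⟫)
        (evn Z c s (pi1 x))
  | Mu c =>
      if evn Z c s ⟪x, find (fun k => evn Z c s ⟪x, k⟫ <= 1) (iota 0 s)⟫ == 1
      then if s <= find (fun k => evn Z c s ⟪x, k⟫ <= 1) (iota 0 s) then 0
           else (find (fun k => evn Z c s ⟪x, k⟫ <= 1) (iota 0 s)).+1
      else 0
  end.

(** The oracle may depend on the input, as happens when a finite set ranging
    over a search plays the role of an initial segment of the oracle. *)
Lemma computable_evn (I : Type) (O : I -> set nat) (P : I -> nat -> set nat) c :
  (forall e k, computable O e -> computable O k ->
    recursive O (fun i z => k i z \in P i (e i z))) ->
  forall e s x, computable O e -> computable O s -> computable O x ->
  computable O (fun i z => evn (P i (e i z)) c (s i z) (x i z)).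
Proof.
move=> Pc; elim: c => [||||| c IHc d IHd|c IHc d IHd|c IHc d IHd|c IHc] e s x ec sc xc /=.
- by computability.
- by computability.
- by computability.
- by computability.
- by computability.
- by computability.
- computability.
- computability.
- computability.
Qed.

Definition agree (s : nat) (A B : set nat) : Prop :=
  forall k, k < s -> A k <-> B k.

Lemma agree_in s A B k : agree s A B -> k < s -> (k \in A) = (k \in B).
Proof. by move=> AB /AB ABk; apply/idP/idP; rewrite !inE => /ABk. Qed.

Lemma agree_sym s A B : agree s A B -> agree s B A.
Proof. by move=> AB k /AB[? ?]; split. Qed.

Lemma agree_trans s A B C : agree s A B -> agree s B C -> agree s A C.
Proof. by move=> AB BC k ks; rewrite (AB k ks) (BC k ks). Qed.

Lemma agree_leq s t A B : s <= t -> agree t A B -> agree s A B.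
Proof. by move=> st AB k ks; apply: AB; apply: leq_trans st. Qed.

Lemma agree_join s A B C : agree s A B ->
  agree s (turing_join A C) (turing_join B C).
Proof.
move=> AB k ks.
suff : (k \in turing_join A C) = (k \in turing_join B C).
  by move=> E; split=> H; apply/set_mem; [rewrite -E|rewrite E]; exact: mem_set.
rewrite !in_join (agree_in AB) //.
by have := odd_double_half k; lia.
Qed.

(** A computation that has converged has only asked questions below its bound,
    so that it survives every change of the oracle beyond it. *)
Lemma evn_mono Z Z' c s t x y : s <= t -> agree s Z Z' ->
  evn Z c s x = y.+1 -> evn Z' c t x = y.+1.
Proof.
move=> st ZZ'; elim: c x y => [||||| c IHc d IHd|c IHc d IHd|c IHc d IHd|c IHc] x y //=.
- case: ltnP => // xs; rewrite leqNgt (leq_trans xs st) /=.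
  by rewrite (agree_in ZZ' xs).
- case Ec : (evn Z c s x) => [|a] //=; case Ed : (evn Z d s x) => [|b] //=.
  by rewrite (IHc _ _ Ec) (IHd _ _ Ed).
- by case Ed : (evn Z d s x) => [|b] //=; rewrite (IHd _ _ Ed) /=; apply: IHc.
- elim: (pi2 x) y => [|k IHk] y /=; first exact: IHc.
  case E : (iteri _ _ _) => [|r] //= Ed.
  by rewrite (IHk _ E) /= (IHd _ _ Ed).
- set n := find _ (iota 0 s); set n' := find _ (iota 0 t).
  case: eqP => // En; case: ltnP => // ns [<-].
  suff -> : n' = n by rewrite (IHc _ _ En) /= leqNgt (leq_trans ns st).
  apply/eqP; rewrite eqn_leq; apply/andP; split.
    rewrite leqNgt; apply/negP => nn'.
    have := before_find 0 nn'.
    by rewrite nth_iota ?(leq_trans ns st) // add0n (IHc _ _ En).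
  rewrite leqNgt; apply/negP => n'n; have n's := ltn_trans n'n ns.
  have := before_find 0 n'n; rewrite nth_iota // add0n.
  case E : (evn Z c s ⟪x, n'⟫) => [|[|r]] // _.
  have n't : has (fun k => evn Z' c t ⟪x, k⟫ <= 1) (iota 0 t).
    by rewrite has_find size_iota; exact: leq_trans n's st.
  have := nth_find 0 n't; rewrite nth_iota; last exact: leq_trans n's st.
  by rewrite add0n (IHc _ _ E).
Qed.

Lemma evn_sound Z c s x y : evn Z c s x = y.+1 -> eval Z c x y.
Proof.
elim: c x y => [||||| c IHc d IHd|c IHc d IHd|c IHc d IHd|c IHc] x y /=.
- by move=> [<-]; apply: eval_zero.
- by move=> [<-]; apply: eval_succ.
- by move=> [<-]; rewrite -[x in eval _ _ x]pairE; apply: eval_fst.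
- by move=> [<-]; rewrite -[x in eval _ _ x]pairE; apply: eval_snd.
- case: ifP => // _ E; suff -> : y = (x \in Z) by exact: eval_oracle.
  by case: ifP E => _ [<-].
- case Ec : (evn Z c s x) => [|a] //=; case Ed : (evn Z d s x) => [|b] //=.
  by move=> [<-]; apply: eval_pair; [apply: IHc|apply: IHd].
- by case Ed : (evn Z d s x) => [|b] //= /IHc; apply: eval_comp; apply: IHd.
- rewrite -[x in eval _ _ x]pairE; move: (pi1 x) (pi2 x) => a n.
  elim: n y => [|k IHk] y /=; first by move=> /IHc; apply: eval_prec0.
  case E : (iteri _ _ _) => [|r] //= /IHd; apply: eval_precS.
  exact: IHk.
- set n := find _ (iota 0 s).
  case: eqP => // En; case: ltnP => // ns [<-].
  apply: (@eval_mu _ _ _ _ (fun m => (evn Z c s ⟪x, m⟫).-2)); last exact: IHc.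
  move=> m mn; apply: IHc; have := before_find 0 mn.
  rewrite nth_iota ?(ltn_trans mn) // add0n.
  by case: (evn _ _ _ _) => [|[|r]].
Qed.

Lemma evn_complete Z c x y : eval Z c x y -> exists s, evn Z c s x = y.+1.
Proof.
elim=> {c x y} [x|x|a b|a b|n|c d x a b _ [s sP] _ [t tP]
  |c d x y z _ [s sP] _ [t tP]|c d a y _ [s sP]|c d a n y z _ [s sP] _ [t tP]
  |c a n h _ IH _ [t tP]].
- by exists 0.
- by exists 0.
- by exists 0; rewrite /= pairK1.
- by exists 0; rewrite /= pairK2.
- by exists n.+1; rewrite /= ltnn; case: (n \in Z).
- exists (maxn s t) => /=.
  rewrite (evn_mono (leq_maxl s t) _ sP) // (evn_mono (leq_maxr s t) _ tP) //=.
- exists (maxn s t) => /=.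
  by rewrite (evn_mono (leq_maxl s t) _ sP) // (evn_mono (leq_maxr s t) _ tP).
- by exists s; rewrite /= pairK1 pairK2.
- exists (maxn s t); move: (evn_mono (leq_maxl s t) (fun _ _ => iff_refl _) sP).
  rewrite /= !pairK1 !pairK2 /= => -> /=.
  by rewrite (evn_mono (leq_maxr s t) _ tP).
- have [u uP] : exists u, forall m, m < n -> evn Z c u ⟪a, m⟫ = (h m).+2.
    elim: n IH {tP} => [|n IHn] IH; first by exists 0.
    have [m mn|u uP] := IHn; first by apply: IH; lia.
    have [s sP] := IH n (ltnSn n); exists (maxn u s) => m.
    rewrite ltnS leq_eqVlt => /orP[/eqP->|mn].
      by rewrite (evn_mono (leq_maxr u s) _ sP).
    by rewrite (evn_mono (leq_maxl u s) _ (uP m mn)).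
  pose v := maxn n.+1 (maxn u t); exists v => /=.
  have nv : n < v by rewrite leq_maxl.
  have En : evn Z c v ⟪a, n⟫ = 1.
    by rewrite (evn_mono _ _ tP) //; rewrite /v; lia.
  suff -> : find (fun k => evn Z c v ⟪a, k⟫ <= 1) (iota 0 v) = n.
    by rewrite En /= leqNgt nv.
  apply/eqP; rewrite eqn_leq; apply/andP; split.
    rewrite leqNgt; apply/negP => /(before_find 0).
    by rewrite nth_iota // add0n En.
  rewrite leqNgt; apply/negP => n'n.
  set n' := find _ _ in n'n; have n'v := ltn_trans n'n nv.
  have : has (fun k => evn Z c v ⟪a, k⟫ <= 1) (iota 0 v).
    by rewrite has_find size_iota.
  move=> /(nth_find 0); rewrite -/n' nth_iota // add0n.
  by rewrite (evn_mono _ _ (uP n' n'n)) //; rewrite /v; lia.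
Qed.

Lemma eval_fun Z c x y y' : eval Z c x y -> eval Z c x y' -> y = y'.
Proof.
move=> /evn_complete[s sP] /evn_complete[t tP].
have := evn_mono (leq_maxl s t) (fun _ _ => iff_refl _) sP.
by rewrite (evn_mono (leq_maxr s t) (fun _ _ => iff_refl _) tP) => -[].
Qed.

Lemma eval_use Z c x y : eval Z c x y ->
  exists s, forall Z', agree s Z Z' -> eval Z' c x y.
Proof.
move=> /evn_complete[s sP]; exists s => Z' ZZ'.
exact: evn_sound (evn_mono (leqnn s) ZZ' sP).
Qed.

Lemma eval_use_join G Z c x y : eval (turing_join G Z) c x y ->
  exists s, forall G', agree s G G' -> eval (turing_join G' Z) c x y.
Proof.
move=> /eval_use[s sP]; exists s => G' GG'.
by apply: sP; apply: agree_join.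
Qed.


(** * Recursively enumerable relations *)

Definition fs (u : nat) : set nat := [set k | bit u k].

Lemma in_fs k u : (k \in fs u) = bit u k.
Proof. by apply/idP/idP; rewrite inE. Qed.

Lemma bit_lt u k : bit u k -> k < u.
Proof.
have H m : iter m half u <= u - m.
  elim: m => [|m IHm] /=; first by rewrite subn0.
  by have := odd_double_half (iter m half u); lia.
by rewrite /bit; case: (iter k half u) (H k) => //=; lia.
Qed.

Lemma fs_exists N (A : set nat) : (forall k, A k -> k < N) ->
  exists u, u < 2 ^ N /\ fs u = A.
Proof.
elim: N A => [|N IHN] A AN.
  exists 0; split=> //; apply/seteqP; split=> k; last by move/AN.
  by move/bit_lt.
have [k|u [uN uA]] := IHN (fun k => A k.+1); first by move/AN.
have uE (b : bool) : (b + u.*2)./2 = u by rewrite half_bit_double.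
exists ((0 \in A) + u.*2); split.
  by rewrite expnS; case: (0 \in A); lia.
apply/seteqP; split=> -[|k]; rewrite /fs /= /bit.
- by rewrite /= oddD odd_double addbF oddb inE.
- by rewrite iterSr uE => ku; suff: fs u k by rewrite uA.
- by move=> A0; rewrite /= oddD odd_double addbF oddb inE.
- by rewrite iterSr uE => Ak; suff: fs u k by []; rewrite uA.
Qed.

Section Enumerable.
Variables (I : Type) (O : I -> set nat).

Definition enumerable (P : I -> nat -> Prop) : Prop :=
  exists2 R : I -> nat -> nat -> bool,
    recursive O (fun i z => R i (pi1 z) (pi2 z)) &
    forall i x, P i x <-> exists m, R i x m.

Lemma enumerable_ext P Q : (forall i x, P i x <-> Q i x) ->
  enumerable P -> enumerable Q.
Proof. by move=> PQ [R Rc RP]; exists R => // i x; rewrite -PQ. Qed.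

Lemma enumerable_recursive (P : I -> nat -> bool) :
  recursive O P -> enumerable (fun i x => P i x).
Proof.
move=> Pc; exists (fun i x _ => P i x); first by computability.
by move=> i x; split=> [|[]//]; exists 0.
Qed.

Lemma enumerable_subst P g : enumerable P -> computable O g ->
  enumerable (fun i x => P i (g i x)).
Proof.
move=> [R Rc RP] gc; exists (fun i x => R i (g i x)) => //.
apply: computable_ext (computable_comp Rc (computable_pair
  (computable_comp gc (computable_pi1 (computable_id _)))
  (computable_pi2 (computable_id _)))) => i x.
by rewrite pairK1 pairK2.
Qed.

Lemma enumerable_ex (P : I -> nat -> nat -> Prop) :
  enumerable (fun i z => P i (pi1 z) (pi2 z)) ->
  enumerable (fun i x => exists m, P i x m).
Proof.
move=> [R Rc RP]; exists (fun i x m => R i ⟪x, pi1 m⟫ (pi2 m)).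
  apply: computable_ext (computable_comp Rc (computable_pair (computable_pair
    (computable_pi1 (computable_id _))
    (computable_pi1 (computable_pi2 (computable_id _))))
    (computable_pi2 (computable_pi2 (computable_id _))))) => i x.
  by rewrite pairK1 !pairK2.
move=> i x; split=> [[m]|[m Rm]].
  move: (RP i ⟪x, m⟫); rewrite pairK1 pairK2 => -> [k Rk].
  by exists ⟪m, k⟫; rewrite pairK1 pairK2.
exists (pi1 m); move: (RP i ⟪x, pi1 m⟫); rewrite pairK1 pairK2 => ->.
by exists (pi2 m).
Qed.

Lemma enumerable_or P Q : enumerable P -> enumerable Q ->
  enumerable (fun i x => P i x \/ Q i x).
Proof.
move=> [R Rc RP] [S Sc SQ].
exists (fun i x m => R i x m || S i x m); first exact: recursive_or.
move=> i x; rewrite RP SQ; split=> [[[m H]|[m H]]|[m /orP[H|H]]].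
- by exists m; rewrite H.
- by exists m; rewrite H orbT.
- by left; exists m.
- by right; exists m.
Qed.

Lemma enumerable_and (P : I -> nat -> bool) Q : recursive O P -> enumerable Q ->
  enumerable (fun i x => P i x /\ Q i x).
Proof.
move=> Pc [S Sc SQ].
exists (fun i x m => P i x && S i x m); first by computability.
move=> i x; rewrite SQ; split=> [[Px [m H]]|[m /andP[Px H]]].
  by exists m; rewrite Px.
by split=> //; exists m.
Qed.

Lemma enumerable_eval (A : I -> nat -> set nat) c e x y :
  (forall e k, computable O e -> computable O k ->
    recursive O (fun i z => k i z \in A i (e i z))) ->
  computable O e -> computable O x -> computable O y ->
  enumerable (fun i z => eval (A i (e i z)) c (x i z) (y i z)).
Proof.
move=> Ac ec xc yc.
exists (fun i z s => evn (A i (e i z)) c s (x i z) == (y i z).+1).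
  apply: recursive_eq; last by computability.
  by apply: computable_evn => //; computability.
move=> i z; split=> [/evn_complete[s sP]|[s /eqP/evn_sound//]].
by exists s; apply/eqP.
Qed.

End Enumerable.

Lemma enumerable_search (I : Type) (O : I -> set nat) (P : I -> nat -> bool) :
  recursive O (fun i z => P i (pi2 z)) -> enumerable O (fun i _ => exists m, P i m).
Proof.
move=> Pc; apply: (enumerable_ex (P := fun i _ m => P i m)).
exact: enumerable_recursive.
Qed.

(** Membership in an effectively open class is witnessed by a computation,
    which has a finite use. *)
Lemma enumerable_open Y P : enumerable (turing_join^~ Y) P ->
  forall A x, P A x -> exists t, forall B, agree t A B -> P B x.
Proof.
move=> [R [c cP] RP] A x /RP[m Rm].
have [t tP] := eval_use_join (cP A ⟪x, m⟫); exists t => B AB.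
apply/RP; exists m; have := eval_fun (tP B AB) (cP B ⟪x, m⟫).
by rewrite pairK1 pairK2 Rm; case: (R B x m).
Qed.

Lemma dependent_choice (T : Type) (P : T -> Prop) (R : nat -> T -> T -> Prop) x0 :
  P x0 -> (forall k x, P x -> exists2 y, P y & R k x y) ->
  exists s : nat -> T, s 0 = x0 /\ forall k, P (s k) /\ R k (s k) (s k.+1).
Proof.
move=> Px0 PR.
have [f fP] : exists f : nat * T -> T,
    forall z, P z.2 -> P (f z) /\ R z.1 z.2 (f z).
  suff /choice[f fP] : forall z : nat * T, exists y,
      P z.2 -> P y /\ R z.1 z.2 y by exists f.
  move=> [k x] /=.
  have [/(PR k)[y Py Ry]|nPx] := pselect (P x); first by exists y.
  by exists x => /nPx.
pose s := fix s k := if k is j.+1 then f (j, s j) else x0.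
exists s; split=> // k.
have Ps : P (s k) by elim: k => //= k IHk; have [] := fP (k, s k) IHk.
by split=> //; have [] := fP (k, s k) Ps.
Qed.

(** Compactness of Cantor space.  The set is built bit by bit so that every
    [Q t] remains satisfiable: if both values of a bit failed, they would fail
    for a common [t]. *)
Lemma konig (Q : nat -> set nat -> Prop) :
  (forall t A B, agree t A B -> Q t A -> Q t B) ->
  (forall s t A, s <= t -> Q t A -> Q s A) ->
  (forall t, exists A, Q t A) ->
  exists A, forall t, Q t A.
Proof.
move=> Qagree Qmono Qex.
pose live k A := forall t, exists2 B, agree k A B & Q t B.
have step k A : live k A -> exists2 B, live k.+1 B & agree k A B.
  move=> lA; apply: contrapT => nB.
  pose C (b : Prop) : set nat := [set j | j < k /\ A j \/ j = k /\ b].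
  have CA b : agree k A (C b).
    by move=> j jk; rewrite /C /=; split=> [Aj|[[]//|[]]]; [left|lia].
  have dead b : exists t, ~ exists2 B, agree k.+1 (C b) B & Q t B.
    by apply/existsNP => lC; apply: nB; exists (C b).
  have [t tP] := dead True; have [t' t'P] := dead False.
  have [B AB QB] := lA (maxn t t').
  have CB b : (b <-> B k) -> agree k.+1 (C b) B.
    move=> bB j; rewrite ltnS leq_eqVlt => /orP[/eqP->|jk].
      by rewrite -bB /C /=; split=> [[[]|[]]//|]; [rewrite ltnn|right].
    by rewrite -(AB j jk) (CA b j jk).
  have [Bk|nBk] := pselect (B k).
    by apply: tP; exists B; [exact: CB|exact: Qmono (leq_maxl _ _) QB].
  by apply: t'P; exists B; [exact: CB|exact: Qmono (leq_maxr _ _) QB].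
have [|k z lz|s [s0 sP]] := @dependent_choice (nat * set nat)
  (fun z => live z.1 z.2) (fun k x y => y.1 = x.1.+1 /\ agree x.1 x.2 y.2) (0, set0).
- by move=> t; have [B QB] := Qex t; exists B.
- by have [B lB AB] := step _ _ lz; exists (z.1.+1, B).
have s1 k : (s k).1 = k.
  elim: k => [|k IHk]; first by rewrite s0.
  by have [_ [-> _]] := sP k; rewrite IHk.
have mono j k : j <= k -> agree (s j).1 (s j).2 (s k).2.
  elim: k => [|k IHk]; first by rewrite leqn0 => /eqP->.
  rewrite leq_eqVlt => /orP[/eqP->//|]; rewrite ltnS => jk.
  apply: agree_trans (IHk jk) _; have [_ [_]] := sP k.
  by apply: agree_leq; rewrite !s1; lia.
exists [set k | (s k.+1).2 k] => t.
have [lt _] := sP t; have [B tB QB] := lt t.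
apply: Qagree QB; apply: agree_sym => j jt.
have js : j < (s j.+1).1 by rewrite s1; lia.
rewrite /= (mono _ _ jt j js); apply: tB.
by rewrite s1; lia.
Qed.

Lemma recursive_in_fs (I : Type) (O : I -> set nat) e k :
  computable O e -> computable O k -> recursive O (fun i z => k i z \in fs (e i z)).
Proof.
by move=> ec kc; apply: computable_ext (recursive_bit ec kc) => i x; rewrite in_fs.
Qed.

Lemma computable_expn2 (I : Type) (O : I -> set nat) e :
  computable O e -> computable O (fun i z => 2 ^ (e i z)).
Proof.
have dc g : computable O g -> computable O (fun i z => (g i z).*2).
  move=> gc; have : computable O (fun i z => iteri (g i z) (fun _ y => y.+2) 0).
    by computability.
  by apply: computable_ext => i z; elim: (g i z) => //= k ->.
move=> ec; have : computable O (fun i z => iteri (e i z) (fun _ y => y.*2) 1).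
  apply: computable_iteri => //; last by computability.
  by apply: dc; computability.
by apply: computable_ext => i z; elim: (e i z) => //= k ->; rewrite expnS mul2n.
Qed.

(** A quantifier over all sets costs nothing: by compactness, it only has to be
    checked on the finite sets below a bound that a search can find. *)
Lemma enumerable_forall (Y : set nat) P : enumerable (turing_join^~ Y) P ->
  enumerable (fun _ : unit => Y) (fun _ x => forall A, P A x).
Proof.
move=> [R [c cP] RP].
pose S A x t := has (fun m => evn (turing_join A Y) c t ⟪x, m⟫ == 2) (iota 0 t).
have SP A x : P A x <-> exists t, S A x t.
  rewrite RP; split=> [[m Rm]|[t /hasP[m _ /eqP/evn_sound E]]].
    have := cP A ⟪x, m⟫; rewrite pairK1 pairK2 Rm => /evn_complete[s sP].
    exists (maxn s m.+1); apply/hasP; exists m; first by rewrite mem_iota; lia.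
    by rewrite (evn_mono (leq_maxl s _) _ sP).
  exists m; have := eval_fun E (cP A _).
  by rewrite pairK1 pairK2; case: (R A x m).
have Smono A B x s t : s <= t -> agree s A B -> S A x s -> S B x t.
  move=> st AB /hasP[m]; rewrite mem_iota => ms /eqP E.
  apply/hasP; exists m; first by rewrite mem_iota; lia.
  by rewrite (evn_mono st _ E) //; apply: agree_join.
exists (fun _ x t => all (fun u => S (fs u) x t) (iota 0 (2 ^ t))).
  apply: recursive_all; last by apply: computable_expn2; computability.
  apply: recursive_has; last by computability.
  apply: recursive_eq; last by computability.
  apply: (computable_evn (P := fun _ u => turing_join (fs u) Y)); try by computability.
  move=> e k ec kc; apply: recursive_join => //.
    by apply: recursive_in_fs; computability.
  by apply: (@recursive_oracle _ (fun _ : unit => Y)); computability.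
move=> _ x; split=> [PA|[t /allP tP] A].
  apply: contrapT => nex.
  have [||t|A AP] := @konig (fun t A => ~ S A x t).
  - by move=> t A B AB nS SB; apply: nS; apply: Smono SB; rewrite // => k kt; split=> /AB; apply.
  - by move=> s t A st nS SA; apply: nS; apply: Smono SA.
  - have : ~ all (fun u => S (fs u) x t) (iota 0 (2 ^ t)) by move=> H; apply: nex; exists t.
    by move=> /negP/allPn[u _ /negP]; exists (fs u).
  by have /SP[t] := PA A; exact: AP.
have [k [] //|u [ut uA]] := @fs_exists t [set k | k < t /\ A k].
apply/SP; exists t; apply: (Smono (fs u)) (leqnn t) _ (tP u _); last by rewrite mem_iota.
by rewrite uA => k kt; split=> [[]|].
Qed.

(** * Avoiding a cone *)

Lemma code_enumeration : exists enum : nat -> code, forall c, exists n, enum n = c.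
Proof.
pose fix enc (c : code) : nat := match c with
  | Zero => ⟪0, 0⟫ | Succ => ⟪1, 0⟫ | Fst => ⟪2, 0⟫ | Snd => ⟪3, 0⟫
  | Oracle => ⟪4, 0⟫
  | Pair c d => ⟪5, ⟪enc c, enc d⟫⟫
  | Comp c d => ⟪6, ⟪enc c, enc d⟫⟫
  | Prec c d => ⟪7, ⟪enc c, enc d⟫⟫
  | Mu c => ⟪8, enc c⟫
  end.
have enc_inj : injective enc.
  elim=> [||||| c IHc d IHd|c IHc d IHd|c IHc d IHd|c IHc];
    case=> [||||| c' d'|c' d'|c' d'|c'] //= /pair_inj[] // _.
  - by move=> /pair_inj[/IHc-> /IHd->].
  - by move=> /pair_inj[/IHc-> /IHd->].
  - by move=> /pair_inj[/IHc-> /IHd->].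
  - by move=> /IHc->.
have [enum enumP] : exists enum : nat -> code,
    forall n, (exists c, enc c = n) -> enc (enum n) = n.
  suff /choice[f fP] : forall n, exists d, (exists c, enc c = n) -> enc d = n.
    by exists f.
  move=> n.
  have [[c cn]|nc] := pselect (exists c, enc c = n); first by exists c.
  by exists Zero => /nc.
by exists enum => c; exists (enc c); apply: enc_inj; apply: enumP; exists c.
Qed.

Definition computes_via (c : code) (Y W : set nat) : Prop :=
  forall n, eval Y c n (n \in W).

Section Cone.
Variables (W Y : set nat).
Hypothesis WY : ~ turing_reducible W Y.

(** If no [n] were answered wrongly by every set, then searching for an answer
    on which all sets agree would compute [W] from [Y]. *)
Lemma wrong_answer V : enumerable (turing_join^~ Y) V ->
  (forall n A, V A ⟪n, n \in W⟫) -> exists n, forall A, V A ⟪n, n \notin W⟫.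
Proof.
move=> /enumerable_forall[R Rc RV] VW; apply: contrapT => nV.
have Rex n : exists z, (pi1 z <= 1) && R tt ⟪n, pi1 z⟫ (pi2 z).
  have [m Rm] := (RV tt ⟪n, n \in W⟫).1 (VW n).
  by exists ⟪n \in W, m⟫; rewrite pairK1 pairK2 Rm andbT; case: (n \in W).
apply: WY; apply/turing_reducibleE.
have : computable (fun _ : unit => Y) (fun _ n => pi1 (ex_minn (Rex n))).
  apply: computable_pi1.
  apply: (computable_min (P := fun _ n z => (pi1 z <= 1) && R tt ⟪n, pi1 z⟫ (pi2 z))).
  - apply: recursive_and; first by computability.
    have := @computable_comp _ _ _ (fun _ z => ⟪⟪pi1 z, pi1 (pi2 z)⟫, pi2 (pi2 z)⟫) Rc.
    move=> /(_ ltac:(by computability)); apply: computable_ext => -[] z.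
    by rewrite pairK1 pairK2.
  - by move=> _ n; case: ex_minnP.
  - by move=> _ n m Rm; case: ex_minnP => z _; apply.
apply: computable_ext => -[] n; case: ex_minnP => z /andP[z1 Rz] _.
apply: contrapT => zW; apply: nV; exists n.
suff <- : pi1 z = (n \notin W) by apply/(RV tt); exists (pi2 z).
by case: (n \in W) zW => /=; lia.
Qed.

(** A class with effectively open complement [P] is shrunk once for each code.
    If some member misses the right answer at some [n], only the members that
    miss it at this [n] are kept.  Otherwise all members always give the right
    answer, and by [wrong_answer] they all give a wrong one somewhere, which is
    absurd since there is a member.  By compactness a set remains in the end. *)
Lemma cone_avoidance_basis P : enumerable (turing_join^~ Y) (fun A _ => P A) ->
  (exists A, ~ P A) -> exists2 A, ~ P A & ~ turing_reducible W (turing_join A Y).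
Proof.
move=> Penum Pex; have [enum enumP] := code_enumeration.
pose good (Q : set nat -> Prop) :=
  enumerable (turing_join^~ Y) (fun A _ => Q A) /\ exists A, ~ Q A.
pose ext k (Q Q' : set nat -> Prop) := (forall A, Q A -> Q' A) /\
  forall A, ~ Q' A -> ~ computes_via (enum k) (turing_join A Y) W.
have step k Q : good Q -> exists2 Q', good Q' & ext k Q Q'.
  move=> [Qenum [A0 nQA0]]; set c := enum k.
  pose V A x := Q A \/ eval (turing_join A Y) c (pi1 x) (pi2 x).
  have Venum : enumerable (turing_join^~ Y) V.
    apply: enumerable_or => //.
    apply: (@enumerable_eval _ _ (fun A _ => turing_join A Y) c (fun _ _ => 0));
      try by computability.
    by move=> e j _ jc; apply: (recursive_oracle (O := turing_join^~ Y)).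
  have [[n [A nVA]]|allV] := pselect (exists n A, ~ V A ⟪n, n \in W⟫).
    exists (fun A => V A ⟪n, n \in W⟫).
      split; last by exists A.
      apply: (enumerable_subst (g := fun _ _ => ⟪n, n \in W⟫) Venum).
      exact: computable_cst.
    split=> [B QB|B nVB cB]; first by left.
    by apply: nVB; right; rewrite pairK1 pairK2; apply: cB.
  have VW n A : V A ⟪n, n \in W⟫.
    by apply: contrapT => nVA; apply: allV; exists n, A.
  have [n nP] := wrong_answer Venum VW.
  have [//|] := VW n A0; have [//|] := nP A0; rewrite !pairK1 !pairK2.
  by move=> E /(eval_fun E); case: (n \in W).
have [s [s0 sP]] := dependent_choice (conj Penum Pex : good P) step.
have mono j k : j <= k -> forall A, s j A -> s k A.
  elim: k => [|k IHk]; first by rewrite leqn0 => /eqP->.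
  rewrite leq_eqVlt => /orP[/eqP->//|]; rewrite ltnS => jk A /(IHk jk).
  by have [_ [+ _]] := sP k; apply.
have [||t|A AP] := @konig (fun t A => forall k, k <= t ->
    exists2 B, agree t A B & ~ s k B).
- move=> t A B AB QA k kt; have [C AC nC] := QA k kt; exists C => //.
  exact: agree_trans (agree_sym AB) AC.
- move=> t u A tu QA k kt; have [C AC nC] := QA k (leq_trans kt tu).
  by exists C => //; apply: agree_leq AC.
- have [[_ [A nA]] _] := sP t; exists A => k kt; exists A => //.
  by move=> /(mono _ _ kt).
have nsA k : ~ s k A.
  move=> skA; have [[senum _] _] := sP k.
  have [t tP] := enumerable_open (x := 0) senum skA.
  have [B AB] := AP (maxn k t) k (leq_maxl _ _).
  by apply; apply: tP; apply: agree_leq AB; exact: leq_maxr.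
exists A; first by rewrite -s0.
move=> [c cW]; have [k kc] := enumP c.
have [_ [_ /(_ A (nsA k.+1))]] := sP k.
by rewrite kc; apply.
Qed.

(** Whether every set [A] supports the answer [i] at [n] is enumerable in [Y],
    so either a wrong answer is supported by all sets, or the right one is
    missed by some set, which can be chosen cone avoiding. *)
Lemma forcing_question V : enumerable (turing_join^~ Y) V ->
  (exists n, forall A, V A ⟪n, n \notin W⟫) \/
  (exists n A, ~ V A ⟪n, n \in W⟫ /\ ~ turing_reducible W (turing_join A Y)).
Proof.
move=> Venum.
have [[n [A nVA]]|allV] := pselect (exists n A, ~ V A ⟪n, n \in W⟫).
  right; exists n; have [||B nVB WB] := @cone_avoidance_basis (fun A => V A ⟪n, n \in W⟫).
  - apply: (enumerable_subst (g := fun _ _ => ⟪n, n \in W⟫) Venum).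
    exact: computable_cst.
  - by exists A.
  by exists B.
left; apply: wrong_answer => // n A.
by apply: contrapT => nVA; apply: allV; exists n, A.
Qed.

End Cone.


(** * Mathias forcing *)

Definition unbounded (X : set nat) : Prop := forall N, exists2 x, X x & N <= x.

Definition tail (N : nat) (X : set nat) : set nat := [set x | X x /\ N <= x].

Definition between (u : nat) (X G : set nat) : Prop :=
  fs u `<=` G /\ G `<=` fs u `|` X.

Lemma unbounded_tail N X : unbounded X -> unbounded (tail N X).
Proof.
move=> Xinf M; have [x Xx] := Xinf (maxn M N); rewrite geq_max => /andP[Mx Nx].
by exists x.
Qed.

Lemma unbounded_split X A : unbounded X ->
  unbounded (X `&` A) \/ unbounded (X `\` A).
Proof.
move=> Xinf; have [|nA] := pselect (unbounded (X `&` A)); first by left.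
have [N NP] : exists N, ~ exists2 x, (X `&` A) x & N <= x by apply/existsNP.
right=> M; have [x Xx] := Xinf (maxn M N); rewrite geq_max => /andP[Mx Nx].
by exists x => //; split=> // Ax; apply: NP; exists x.
Qed.

Lemma betweenS u u' X X' G :
  between u X (fs u') -> X' `<=` fs u `|` X -> between u' X' G -> between u X G.
Proof.
move=> [uu' u'X] X'X [u'G GX']; split; first exact: subset_trans u'G.
by move=> x /GX'[/u'X|/X'X].
Qed.

Lemma reducible_recursive (Y X : set nat) (P : nat -> bool) :
  recursive (fun _ : unit => Y) (fun _ => P) -> (forall x, X x <-> P x) ->
  turing_reducible X Y.
Proof.
move=> Pc XP; apply/turing_reducibleE; apply: computable_ext Pc => _ x.
by congr nat_of_bool; apply/idP/idP; rewrite inE => /XP.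
Qed.

Lemma turing_refl X : turing_reducible X X.
Proof.
apply: (reducible_recursive (P := fun x => x \in X)) => [|x]; last by rewrite inE.
by apply: recursive_oracle; computability.
Qed.

Lemma reducible_joinl X Y : turing_reducible X (turing_join X Y).
Proof.
apply/turing_reducibleE.
exact: (uniformly_below_joinl (fun _ : unit => X) (fun=> Y)).
Qed.

Lemma reducible_joinr X Y : turing_reducible Y (turing_join X Y).
Proof.
apply/turing_reducibleE.
exact: (uniformly_below_joinr (fun _ : unit => X) (fun=> Y)).
Qed.

Lemma join_reducible X Y U : turing_reducible X U -> turing_reducible Y U ->
  turing_reducible (turing_join X Y) U.
Proof. by rewrite !turing_reducibleE; apply: uniformly_below_join. Qed.

Lemma recursive_in (Y X : set nat) : turing_reducible X Y ->
  recursive (fun _ : unit => Y) (fun _ x => x \in X).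
Proof. by move/turing_reducibleE. Qed.

Lemma tail_reducible N X : turing_reducible (tail N X) X.
Proof.
apply: (reducible_recursive (P := fun x => (x \in X) && (N <= x))).
  apply: recursive_and; last by computability.
  by apply: recursive_oracle; computability.
move=> x; rewrite /tail /=; split=> [[Xx Nx]|/andP[]]; last by rewrite inE.
by rewrite Nx mem_set.
Qed.

Section Mathias.
Variables W Z : set nat.

Definition avoiding (X : set nat) : Prop :=
  ~ turing_reducible W (turing_join X Z).

Lemma avoiding_below X Y : ~ turing_reducible W Y ->
  turing_reducible X Y -> turing_reducible Z Y -> avoiding X.
Proof. by move=> WY XY ZY /turing_trans WX; apply: WY (WX _ (join_reducible XY ZY)). Qed.

Lemma avoiding_tail N X : avoiding X -> avoiding (tail N X).
Proof.
move=> aX; apply: avoiding_below aX _ (reducible_joinr _ _).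
exact: turing_trans (tail_reducible _ _) (reducible_joinl _ _).
Qed.

(** Being a rainbow, or a subset of a given set, is of finite character: it is
    enough to test the finite subsets. *)
Definition finitely (T : set nat -> Prop) (G : set nat) : Prop :=
  forall E, fs E `<=` G -> T (fs E).

Definition forces T (c : code) (u : nat) (X : set nat) : Prop :=
  forall G, finitely T G -> between u X G ->
    ~ computes_via c (turing_join G Z) W.

(** A wrong value seen on a finite set persists as long as nothing is added
    below the use of the computation. *)
Lemma forces_wrong T c E n i : eval (turing_join (fs E) Z) c n i ->
  i != (n \in W) -> exists s, forall Y, (forall y, Y y -> s <= y) -> forces T c E Y.
Proof.
move=> /eval_use_join[s sP] iW; exists s => Y sY G _ [EG GY] /(_ n) Gn.
move: iW; rewrite (eval_fun (sP G _) Gn) ?eqxx // => k ks.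
by split=> [/EG//|/GY[//|/sY]]; lia.
Qed.

(** A correct value on an infinite set would already be seen on the finite part
    of it below the use. *)
Lemma forces_miss T c u X n :
  (forall E, T (fs E) -> between u X (fs E) ->
    ~ eval (turing_join (fs E) Z) c n (n \in W)) -> forces T c u X.
Proof.
move=> miss G TG [uG GX] /(_ n)/eval_use_join[s sP].
have [k|E [_ EE]] := @fs_exists (s + u) [set k | k < s /\ G k \/ fs u k].
  by move=> [[ks _]|/bit_lt]; lia.
apply: (miss E).
- by apply: TG; rewrite EE => k [[]|/uG].
- rewrite EE; split=> [k uk|k [[_ /GX]|uk]] //; first by right.
  by left.
- by apply: sP => k ks; rewrite EE /=; split=> [Gk|[[]|/uG]//]; left.
Qed.

(** The generic set is the union of the finite parts of a descending sequence of
    conditions, hence compatible with all of them. *)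
Lemma mathias_generic (good : nat -> set nat -> Prop) T u0 X0 : good u0 X0 ->
  (forall u X, good u X -> finitely T (fs u)) ->
  (forall c u X, good u X -> exists u' X',
    [/\ good u' X', between u X (fs u'), X' `<=` fs u `|` X & forces T c u' X']) ->
  (forall N u X, good u X -> exists u' X',
    [/\ good u' X', between u X (fs u'), X' `<=` fs u `|` X &
        exists2 k, fs u' k & N <= k]) ->
  exists G, [/\ unbounded G, avoiding G, between u0 X0 G & finitely T G].
Proof.
move=> good0 goodT gforce ginf; have [enum enumP] := code_enumeration.
pose R k (p q : nat * set nat) := [/\ between p.1 p.2 (fs q.1),
  q.2 `<=` fs p.1 `|` p.2, forces T (enum k) q.1 q.2 & exists2 j, fs q.1 j & k <= j].
have [k [u X] gp|s [s0 sP]] := @dependent_choice (nat * set nat)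
  (fun p => good p.1 p.2) R (u0, X0) good0.
  have [u1 [X1 [g1 b1 s1 f1]]] := gforce (enum k) u X gp.
  have [u2 [X2 [g2 b2 s2 f2]]] := ginf k u1 X1 g1.
  have b21 G : between u2 X2 G -> between u1 X1 G by apply: betweenS.
  exists (u2, X2) => //; split=> //=.
  - exact: betweenS b1 s1 b2.
  - by move=> x /s2[|/s1//]; case: b1 => _; apply.
  - by move=> G TG /b21; apply: f1.
have bmono j k : j <= k -> forall G,
    between (s k).1 (s k).2 G -> between (s j).1 (s j).2 G.
  elim: k => [|k IHk]; first by rewrite leqn0 => /eqP->.
  rewrite leq_eqVlt => /orP[/eqP->//|]; rewrite ltnS => jk G bG.
  by apply: IHk => //; have [_ [b1 s1 _ _]] := sP k; apply: betweenS bG.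
have bself k : between (s k).1 (s k).2 (fs (s k).1) by split=> x //; left.
have fmono j k : j <= k -> fs (s j).1 `<=` fs (s k).1.
  by move=> jk; have [] := bmono _ _ jk _ (bself k).
pose G := [set x | exists k, fs (s k).1 x].
have bG k : between (s k).1 (s k).2 G.
  split=> [x sx|x [j sj]]; first by exists k.
  have [_] := bmono _ _ (leq_maxl k j) _ (bself _); apply.
  exact: fmono (leq_maxr k j) _ sj.
have Gfin N : exists k, forall j, j < N -> G j -> fs (s k).1 j.
  elim: N => [|N [k kP]]; first by exists 0.
  have [[j sj]|nGN] := pselect (G N); last first.
    by exists k => i; rewrite ltnS leq_eqVlt => /orP[/eqP->|]; [|apply: kP].
  exists (maxn k j) => i; rewrite ltnS leq_eqVlt => /orP[/eqP-> _|iN Gi].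
    exact: fmono (leq_maxr k j) _ sj.
  by apply: fmono (leq_maxl k j) _ _; apply: kP.
have TG : finitely T G.
  move=> E EG; have [k kP] := Gfin E; have [/goodT gk _] := sP k.
  by apply: gk => j Ej; apply: kP; [exact: bit_lt|exact: EG].
exists G; split=> //.
- move=> N; have [_ [_ _ _ [j sj Nj]]] := sP N.
  by exists j => //; exists N.+1.
- move=> [c cW]; have [k kc] := enumP c.
  by have [_ [_ _ + _]] := sP k; rewrite kc => /(_ G TG (bG _)).
- by have := bG 0; rewrite s0.
Qed.

End Mathias.

(** * Strong cone avoidance for one set *)

(** The digits of a number have positions below it, which bounds both
    quantifiers. *)
Definition betweenb (u : nat) (P : nat -> bool) (E : nat) : bool :=
  all (fun k => bit u k ==> bit E k) (iota 0 u) &&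
  all (fun k => bit E k ==> bit u k || P k) (iota 0 E).

Lemma betweenP u (X : set nat) E (P : nat -> bool) : (forall x, P x <-> X x) ->
  betweenb u P E <-> between u X (fs E).
Proof.
move=> PX; split=> [/andP[/allP uE /allP EX]|[uE EX]].
  split=> k kP.
    by have := uE k; rewrite mem_iota (bit_lt kP) (kP : bit u k); apply.
  have := EX k; rewrite mem_iota (bit_lt kP) (kP : bit E k) /=.
  by move=> /(_ isT)/orP[|/PX]; [left|right].
apply/andP; split; apply/allP => k _; apply/implyP => /[dup] kP.
  by move=> /uE.
by move=> /EX[->//|/PX->]; rewrite orbT.
Qed.

Lemma recursive_between (I : Type) (O : I -> set nat) u e P :
  computable O e -> recursive O (fun i z => P i (pi1 z) (pi2 z)) ->
  recursive O (fun i x => betweenb u (P i x) (e i x)).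
Proof. by move=> ec Pc; rewrite /betweenb; computability. Qed.

Section Partition.
Variables W Z : set nat.

Local Notation avoiding := (avoiding W Z).

Definition side (B : set nat) u X : Prop :=
  [/\ fs u `<=` B, unbounded X & avoiding X].

(** Building a solution inside [B] can only fail at a condition none of whose
    extensions decides some functional. *)
Lemma stuck_side B X0 : unbounded X0 -> avoiding X0 ->
  ~ (exists Y, [/\ unbounded Y, avoiding Y, Y `<=` X0 & Y `<=` B]) ->
  ~ (exists Y, [/\ unbounded Y, avoiding Y, Y `<=` X0 & Y `<=` ~` B]) ->
  exists c u X, [/\ side B u X, X `<=` X0 &
    forall u' X', side B u' X' -> between u X (fs u') -> X' `<=` X ->
      ~ forces W Z (fun E => E `<=` B) c u' X'].
Proof.
move=> X0inf aX0 nB nCB; apply: contrapT => unstuck; apply: nB.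
pose good u X := side B u X /\ between 0 X0 (fs u) /\ X `<=` X0.
have fs0 : fs 0 = set0 by apply/seteqP; split=> k // /bit_lt.
have [||||G [Ginf aG [_ GX] GB]] :=
  @mathias_generic W Z good (fun E => E `<=` B) 0 X0.
- by split; [split=> //; rewrite fs0|split=> //; split=> // k; left].
- by move=> u X [[uB _ _] _] E Eu; apply: subset_trans uB.
- move=> c u X [sX [bu XX0]]; apply: contrapT => nforce; apply: unstuck.
  exists c, u, X; split=> // u' X' s' b' X'X f'; apply: nforce.
  exists u', X'; split=> //; last by move=> x /X'X; right.
  split=> //; split; last exact: subset_trans XX0.
  by apply: betweenS bu _ b' => x /XX0; right.
- move=> N u X [[uB Xinf aX] [bu XX0]].
  have [k [[Xk Nk] Bk]] : exists k, tail N X k /\ B k.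
    apply: contrapT => nk; apply: nCB; exists (tail N X); split.
    + exact: unbounded_tail.
    + exact: avoiding_tail.
    + by move=> x [/XX0].
    + by move=> x Xx Bx; apply: nk; exists x.
  have [j|v [_ vE]] := @fs_exists (u + k).+1 [set j | fs u j \/ j = k].
    by move=> [/bit_lt|->]; lia.
  have bv : between u X (fs v).
    by rewrite vE; split=> j; [left|move=> [|->]; [left|right]].
  exists v, X; split=> //; last by exists k => //; rewrite vE; right.
  split; last by split=> //; apply: betweenS bu _ bv => x /XX0; right.
  by split=> //; rewrite vE => j [/uB|->].
exists G; split=> //.
  by move=> x /GX[|//]; rewrite fs0.
move=> x Gx; have [k ->|E [_ EE]] := @fs_exists x.+1 [set k | k = x].
  exact: ltnSn.
by apply: (GB E) => [k|]; rewrite EE // => ->.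
Qed.

(** Strong cone avoidance for the infinite pigeonhole principle.  If both
    sides were stuck, a single question about both stuck conditions would
    unblock one of them. *)
Lemma pigeonhole_avoiding A X : unbounded X -> avoiding X ->
  exists Y, [/\ unbounded Y, avoiding Y, Y `<=` X & Y `<=` A \/ Y `<=` ~` A].
Proof.
move=> Xinf aX; apply: contrapT => nY.
have [||||c1 [u1 [X1 [[u1A X1inf aX1] X1X stuck1]]]] := @stuck_side A X.
- by [].
- by [].
- by move=> [Y [? ? ? ?]]; apply: nY; exists Y; split=> //; left.
- by move=> [Y [? ? ? ?]]; apply: nY; exists Y; split=> //; right.
have [||||c2 [u2 [X2 [[u2A X2inf aX2] X2X1 stuck2]]]] := @stuck_side (~` A) X1.
- by [].
- by [].
- move=> [Y [? ? YX1 ?]]; apply: nY; exists Y; split=> //; last by right.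
  exact: subset_trans X1X.
- rewrite setCK => -[Y [? ? YX1 ?]]; apply: nY; exists Y; split=> //; last by left.
  exact: subset_trans X1X.
pose ans (B : set nat) c u (p : bool) x := exists E,
  betweenb u (fun k => (k \in X2) && (if p then k \in B else k \notin B)) E /\
  eval (turing_join (fs E) Z) c (pi1 x) (pi2 x).
have ansP (B : set nat) c u p n i : ans B c u p ⟪n, i⟫ <-> exists E,
    between u (X2 `&` (if p then B else ~` B)) (fs E) /\
    eval (turing_join (fs E) Z) c n i.
  rewrite /ans pairK1 pairK2.
  have bP E : betweenb u (fun k => (k \in X2) && (if p then k \in B else k \notin B)) E <->
      between u (X2 `&` (if p then B else ~` B)) (fs E).
    apply: betweenP => x; split=> [/andP[/set_mem X2x]|[X2x]].
      by case: p => [/set_mem|/negP xB] //; split=> // /mem_set.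
    rewrite (mem_set X2x) /=; case: p => [Bx|nBx]; first by rewrite mem_set.
    by rewrite memNset.
  by split=> -[E [/bP ? ?]]; exists E.
pose V (B : set nat) x := ans B c1 u1 true x \/ ans B c2 u2 false x.
pose Y := turing_join X2 Z.
have X2c : uniformly_below (turing_join^~ Y) (fun=> X2).
  apply: uniformly_below_trans (reducible_joinl X2 Z) _.
  exact: uniformly_below_joinr.
have Zc : uniformly_below (turing_join^~ Y) (fun=> Z).
  apply: uniformly_below_trans (reducible_joinr X2 Z) _.
  exact: uniformly_below_joinr.
have Bc : uniformly_below (turing_join^~ Y) id by apply: uniformly_below_joinl.
have Venum : enumerable (turing_join^~ Y) V.
  have ansenum c u p : enumerable (turing_join^~ Y) (fun B => ans B c u p).
    apply: enumerable_ex; apply: enumerable_and.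
      apply: (@recursive_between _ _ u (fun _ => pi2)
        (fun B _ k => (k \in X2) && (if p then k \in B else k \notin B))).
        by computability.
      apply: recursive_and; first by apply: (recursive_mem X2c); computability.
      have Bz : recursive (turing_join^~ Y) (fun B z => pi2 z \in B).
        by apply: (recursive_mem Bc); computability.
      by case: p; computability.
    apply: (@enumerable_eval _ _ (fun _ E => turing_join (fs E) Z) c
      (fun _ z => pi2 z)); try by computability.
    move=> e k ec kc; apply: recursive_join => //.
      by apply: recursive_in_fs; computability.
    by apply: (recursive_mem Zc); computability.
  by apply: enumerable_or; apply: ansenum.
have [[n VW]|[n [B [nV aB]]]] := forcing_question aX2 Venum.
  (* A wrong answer for [A] itself decides a functional on one of the sides. *)
  have nW : (n \notin W : nat) != (n \in W) by case: (n \in W).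
  have [/ansP[E [bE /forces_wrong/(_ nW) fE]]
       |/ansP[E [bE /forces_wrong/(_ nW) fE]]] := VW A.
  - have [s sP] := fE (fun E => E `<=` A).
    apply: (stuck1 E (tail s X2)); last by apply: sP => y [].
    + split; [|exact: unbounded_tail|exact: avoiding_tail].
      by case: bE => _ EA x /EA[/u1A|[]].
    + by case: bE => uE EA; split=> // x /EA[|[/X2X1]]; [left|right].
    + by move=> x [/X2X1].
  - have [s sP] := fE (fun E => E `<=` ~` A).
    apply: (stuck2 E (tail s X2)); last by apply: sP => y [].
    + split; [|exact: unbounded_tail|exact: avoiding_tail].
      by case: bE => _ EA x /EA[/u2A|[]].
    + by case: bE => uE EA; split=> // x /EA[|[? _]]; [left|right].
    + by move=> x [].
(* A cone avoiding [B] misses the right answer on both sides, and one of the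
   two halves into which [B] splits the reservoir is infinite. *)
have ZBY : turing_reducible Z (turing_join B Y).
  exact: turing_trans (reducible_joinr X2 Z) (reducible_joinr _ _).
have Bc1 : recursive (fun _ : unit => turing_join B Y) (fun _ x => x \in B).
  exact: recursive_in (reducible_joinl _ _).
have X2c1 : recursive (fun _ : unit => turing_join B Y) (fun _ x => x \in X2).
  exact: recursive_in (turing_trans (reducible_joinl X2 Z) (reducible_joinr _ _)).
have bself u X' : between u X' (fs u) by split=> // x; left.
have [X2B|X2B] := unbounded_split B X2inf.
- apply: (stuck1 u1 (X2 `&` B)) => //.
  + split=> //; apply: avoiding_below aB _ ZBY.
    apply: (reducible_recursive (P := fun x => (x \in X2) && (x \in B))).
      by computability.
    by move=> x; split=> [[? ?]|/andP[/set_mem? /set_mem]] //; rewrite !mem_set.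
  + by move=> x [/X2X1].
  + apply: (forces_miss (n := n)) => E _ bE ev; apply: nV; left.
    by apply/ansP; exists E.
- apply: (stuck2 u2 (X2 `\` B)) => //.
  + split=> //; apply: avoiding_below aB _ ZBY.
    apply: (reducible_recursive (P := fun x => (x \in X2) && ~~ (x \in B))).
      by computability.
    move=> x; split=> [[? ?]|/andP[/set_mem? /negP xB]].
      by rewrite mem_set // memNset.
    by split=> // /mem_set.
  + apply: (forces_miss (n := n)) => E _ bE ev; apply: nV; right.
    by apply/ansP; exists E.
Qed.

(** By iterated use of [pigeonhole_avoiding], every [S k] is decided at a finite
    stage; statements about a finite set depend on finitely many stages. *)
Lemma cohesive_sequence (S : nat -> set nat) X : unbounded X -> avoiding X ->
  exists Y : nat -> set nat, [/\ forall k, unbounded (Y k) /\ avoiding (Y k),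
    forall k, Y k `<=` X, forall j k, j <= k -> Y k `<=` Y j &
    forall k, Y k.+1 `<=` S k \/ Y k.+1 `<=` ~` S k].
Proof.
move=> Xinf aX.
have [//|k U [Uinf aU]|Y [Y0 YP]] := @dependent_choice (set nat)
  (fun Y => unbounded Y /\ avoiding Y)
  (fun k Y Y' => Y' `<=` Y /\ (Y' `<=` S k \/ Y' `<=` ~` S k)) X.
  by have [V [? ? ? ?]] := pigeonhole_avoiding (S k) Uinf aU; exists V.
have mono j k : j <= k -> Y k `<=` Y j.
  elim: k => [|k IHk]; first by rewrite leqn0 => /eqP->.
  rewrite leq_eqVlt => /orP[/eqP->//|]; rewrite ltnS => jk.
  by apply: subset_trans (IHk jk); have [_ []] := YP k.
exists Y; split=> // k; last by have [_ []] := YP k.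
  by have [] := YP k.
by rewrite -Y0; apply: mono.
Qed.

End Partition.


(** * Matchings on pairs *)

Definition link (A : set nat) (p q : nat) : bool :=
  (p != q) && ((⟪p, q⟫ \in A) || (⟪q, p⟫ \in A)).

Definition matching (A : set nat) : Prop :=
  forall p q r, link A p q -> link A p r -> q = r.

Definition pair_free (A G : set nat) : Prop :=
  forall a b c d, G a -> G b -> G c -> G d -> a < b -> c < d ->
    ~~ link A ⟪a, b⟫ ⟪c, d⟫.

(** A point [a] is represented by the diagonal pair [⟪a, a⟫], so that one set
    carries a matching of pairs together with a matching of points. *)
Definition point_free (A G : set nat) : Prop :=
  forall a c, G a -> G c -> ~~ link A ⟪a, a⟫ ⟪c, c⟫.

Definition same_pairs (A B : set nat) : Prop :=
  forall a b c d, a < b -> c < d ->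
    link A ⟪a, b⟫ ⟪c, d⟫ = link B ⟪a, b⟫ ⟪c, d⟫.

Lemma recursive_link (I : Type) (O : I -> set nat) A p q :
  uniformly_below O A -> computable O p -> computable O q ->
  recursive O (fun i x => link (A i) (p i x) (q i x)).
Proof.
move=> Ac pc qc.
rewrite /link; apply: recursive_and; first by computability.
by apply: recursive_or; apply: (recursive_mem Ac); computability.
Qed.

Lemma link_sym A p q : link A p q = link A q p.
Proof. by rewrite /link eq_sym orbC. Qed.

Lemma pair_free_sub A G G' : G' `<=` G -> pair_free A G -> pair_free A G'.
Proof. by move=> sG AG a b c d /sG ? /sG ? /sG ? /sG ?; apply: AG. Qed.

Lemma point_free_sub A G G' : G' `<=` G -> point_free A G -> point_free A G'.
Proof. by move=> sG AG a c /sG ? /sG ?; apply: AG. Qed.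

Lemma same_pairs_free A B G : same_pairs A B -> pair_free A G -> pair_free B G.
Proof. by move=> AB AG a b c d *; rewrite -AB //; apply: AG. Qed.

Lemma bounded_collection (P : nat -> nat -> Prop) n :
  (forall k, k < n -> exists m, forall j, P k j -> j < m) ->
  exists m, forall k j, k < n -> P k j -> j < m.
Proof.
elim: n => [|n IHn] Pn; first by exists 0.
have [k kn|m mP] := IHn; first by apply: Pn; lia.
have [m' m'P] := Pn n (ltnSn n); exists (maxn m m') => k j.
rewrite ltnS leq_eqVlt => /orP[/eqP->/m'P|kn /(mP _ _ kn)]; lia.
Qed.

Lemma bounded_collection2 (P : nat -> nat -> nat -> Prop) n :
  (forall a b, a < n -> b < n -> exists m, forall j, P a b j -> j < m) ->
  exists m, forall a b j, a < n -> b < n -> P a b j -> j < m.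
Proof.
move=> Pn; have [a an|m mP] :=
  @bounded_collection (fun a j => exists2 b, b < n & P a b j) n.
  have [b bn|m mP] := @bounded_collection (P a) n; first exact: Pn.
  by exists m => j [b bn]; apply: mP.
by exists m => a b j an bn Pj; apply: (mP a) => //; exists b.
Qed.

Lemma matching_bounded A p : matching A ->
  exists m, forall q, link A p q -> q < m.
Proof.
move=> mA; have [[q pq]|npq] := pselect (exists q, link A p q).
  by exists q.+1 => r /(mA _ _ _ pq)->.
by exists 0 => q pq; case: npq; exists q.
Qed.

(** Of two linked elements of [X] the larger is dropped, and so is every element
    linked to [fs u].  Partners are unique, so that an element that loses to a
    smaller one leaves the latter without any other opponent: if only finitely
    many elements were kept, only finitely many could lose. *)
Lemma point_free_thinning A Y X u : matching A -> unbounded X ->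
  point_free A (fs u) -> turing_reducible A Y -> turing_reducible X Y ->
  exists X', [/\ unbounded X', X' `<=` X, turing_reducible X' Y &
                 point_free A (fs u `|` X')].
Proof.
move=> mA Xinf Au AY XY.
pose keep x := [&& x \in X,
  all (fun a => bit u a ==> ~~ link A ⟪a, a⟫ ⟪x, x⟫) (iota 0 u) &
  all (fun a => (a \in X) ==> ~~ link A ⟪a, a⟫ ⟪x, x⟫) (iota 0 x)].
have keepP x : keep x <-> [/\ X x, forall a, fs u a -> ~~ link A ⟪a, a⟫ ⟪x, x⟫ &
    forall a, a < x -> X a -> ~~ link A ⟪a, a⟫ ⟪x, x⟫].
  split=> [/and3P[/set_mem Xx /allP ux /allP xx]|[Xx ux xx]].
    split=> // a; last by move=> ax /mem_set Xa; have := xx a; rewrite mem_iota Xa; apply.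
    by move=> ua; have := ux a; rewrite mem_iota (ua : bit u a); apply; exact: bit_lt.
  apply/and3P; split; first exact: mem_set.
    by apply/allP => a _; apply/implyP => /ux.
  by apply/allP => a; rewrite mem_iota => /= ax; apply/implyP => /set_mem; apply: xx.
exists [set x | keep x]; split.
- move=> N; apply: contrapT => nN.
  have keepN x : keep x -> x < N.
    by move=> kx; rewrite ltnNge; apply/negP => Nx; apply: nN; exists x.
  (* [M] bounds the partners of the elements below [u + N], so that an element
     of [X] beyond [M] cannot lose. *)
  have [M MP] : exists M, forall a x, a < u + N -> link A ⟪a, a⟫ ⟪x, x⟫ -> x < M.
    apply: (@bounded_collection (fun a x => link A ⟪a, a⟫ ⟪x, x⟫)) => a _.
    have [m mP] := matching_bounded ⟪a, a⟫ mA; exists m => x /mP.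
    by have := leq_pair x x; lia.
  have [x Xx Mx] := Xinf (M + N + u); apply: nN; exists x; last by lia.
  apply/keepP; split=> // [a ua|a ax Xa]; apply/negP => axl.
    by have := bit_lt ua; have := MP a x; move=> /(_ _ axl); lia.
  have : keep a.
    have ax' b : link A ⟪b, b⟫ ⟪a, a⟫ -> b = x.
      by rewrite link_sym => /(mA _ _ _ axl) /pair_inj[].
    apply/keepP; split=> // [b ub|b ba _]; apply/negP => /ax' bx.
      by have := bit_lt ub; lia.
    by lia.
  by move=> /keepN aN; have := MP a x; move=> /(_ _ axl); lia.
- by move=> x /keepP[].
- apply: (reducible_recursive (P := keep)) => //.
  have Ac := recursive_in AY; have Xc := recursive_in XY.
  
  have linkc e k : computable (fun _ : unit => Y) e -> computable (fun=> Y) k ->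
      recursive (fun=> Y) (fun i x => link A (e i x) (k i x)).
    exact: (recursive_link Ac).
  by rewrite /keep; computability.
- move=> a c [ua|/keepP[Xa ua xa]] [uc|/keepP[Xc uc xc]].
  + exact: Au.
  + exact: uc.
  + by rewrite link_sym; apply: ua.
  + case: (ltngtP a c) => [ac|ca|->]; [exact: xc|by rewrite link_sym; exact: xa|].
    by rewrite /link eqxx.
Qed.

(** * Rainbow conditions *)

Section Rainbow.
Variable W : set nat.

Definition admissible Z (M : set nat) (u : nat) (X : set nat) : Prop :=
  [/\ unbounded X, avoiding W Z X & forall x, X x -> pair_free M (fs u `|` [set x])].

(** The points [a] and [c] are linked by [L] when [(a, y)] and [(c, y)] are
    linked by [M] for almost all [y] along a descending sequence of reservoirs
    that decides each such question.  Let [E] be free for [M] and for [L].  A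
    member of the sequence that has decided all questions about [E] is a
    reservoir for it, once the finitely many partners of the pairs of [E] have
    been cut off. *)
Lemma limit_matching Z M u X : matching M -> admissible Z M u X ->
  exists L, [/\ matching L, same_pairs L M, point_free L (fs u) &
    forall E s, between u X (fs E) -> pair_free M (fs E) -> point_free L (fs E) ->
      exists Y, [/\ admissible Z M E Y, Y `<=` X & forall y, Y y -> s <= y]].
Proof.
move=> mM [Xinf aX MX].
pose S k := [set y | link M ⟪pi1 k, y⟫ ⟪pi2 k, y⟫].
have [Y [Yinf YX Ymono YS]] := cohesive_sequence S Xinf aX.
have Ypick k N : exists y, [/\ Y k y & N <= y].
  by have [/(_ N)[y Yy Ny] _] := Yinf k; exists y.
pose lim a c := forall y, Y ⟪a, c⟫.+1 y -> link M ⟪a, y⟫ ⟪c, y⟫.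
have limP a c k y : ⟪a, c⟫ < k -> Y k y -> lim a c <-> link M ⟪a, y⟫ ⟪c, y⟫.
  move=> ack /(Ymono _ _ ack) Yy; split=> [|acy]; first exact.
  have := YS ⟪a, c⟫; rewrite /S pairK1 pairK2 => -[YS1 z /YS1//|].
  by move=> /(_ y Yy).
have lim_sym a c : lim a c -> lim c a.
  have [y [Yy _]] := Ypick (maxn ⟪a, c⟫ ⟪c, a⟫).+1 0.
  rewrite (limP _ _ _ _ _ Yy) ?ltnS ?leq_maxl //.
  by rewrite (limP _ _ _ _ _ Yy) ?ltnS ?leq_maxr // link_sym.
have lim_neq a c : lim a c -> a != c.
  have [y [Yy _]] := Ypick ⟪a, c⟫.+1 0; move=> /(_ y Yy) /andP[+ _].
  by apply: contra => /eqP->.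
pose L : set nat := [set z |
  (exists p q, [/\ z = ⟪p, q⟫, pi1 p < pi2 p, pi1 q < pi2 q & link M p q]) \/
  (exists a c, z = ⟪⟪a, a⟫, ⟪c, c⟫⟫ /\ lim a c)].
have LP p q : link L p q <->
    [/\ pi1 p < pi2 p, pi1 q < pi2 q & link M p q] \/
    (exists a c, [/\ p = ⟪a, a⟫, q = ⟪c, c⟫ & lim a c]).
  split.
    move=> /andP[_ /orP[]] /set_mem[].
    - by move=> [p' [q' [/pair_inj[-> ->]]]]; left.
    - by move=> [a [c [/pair_inj[-> ->] ac]]]; right; exists a, c.
    - by move=> [p' [q' [/pair_inj[-> ->]]]]; rewrite link_sym; left.
    - by move=> [a [c [/pair_inj[-> ->] /lim_sym ac]]]; right; exists c, a.
  move=> H; apply/andP; split.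
    case: H => [[_ _ /andP[]//]|[a [c [-> -> /lim_neq]]]].
    by apply: contra => /eqP/pair_inj[->].
  apply/orP; left; apply/mem_set; case: H => [[? ? ?]|[a [c [-> -> ac]]]].
    by left; exists p, q.
  by right; exists a, c.
have LlimP a c : link L ⟪a, a⟫ ⟪c, c⟫ <-> lim a c.
  rewrite LP; split=> [[[]|]|ac].
  - by rewrite pairK1 pairK2 ltnn.
  - by move=> [a' [c' [/pair_inj[-> _] /pair_inj[-> _]]]].
  - by right; exists a, c.
exists L; split.
- move=> p q r /LP[[pp _ pq]|[a [c [-> -> ac]]]] /LP[[pp' _ pr]|[a' [c' [+ -> ac']]]].
  + exact: mM pq pr.
  + by move=> pE; move: pp; rewrite pE pairK1 pairK2 ltnn.
  + by move: pp'; rewrite pairK1 pairK2 ltnn.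
  + move=> /pair_inj[E _]; subst a'.
    have [y [Yy _]] := Ypick (maxn ⟪a, c⟫ ⟪a, c'⟫).+1 0.
    have /limP/(_ Yy) H : ⟪a, c⟫ < (maxn ⟪a, c⟫ ⟪a, c'⟫).+1 by rewrite ltnS leq_maxl.
    have /limP/(_ Yy) H' : ⟪a, c'⟫ < (maxn ⟪a, c⟫ ⟪a, c'⟫).+1 by rewrite ltnS leq_maxr.
    by have /pair_inj[-> _] := mM _ _ _ (H.1 ac) (H'.1 ac').
- move=> a b c d ab cd; apply/idP/idP => [/LP[[]//|]|Mabcd].
    by move=> [a' [c' [/pair_inj[? ?]]]]; lia.
  by apply/LP; left; rewrite !pairK1 !pairK2.
- move=> a c ua uc; apply/negP => /LlimP ac.
  have [y [Yy uy]] := Ypick ⟪a, c⟫.+1 u.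
  have /limP/(_ Yy) H : ⟪a, c⟫ < ⟪a, c⟫.+1 by [].
  have ay := leq_trans (bit_lt ua) uy; have cy := leq_trans (bit_lt uc) uy.
  apply: negP (H.1 ac); apply: (MX y (YX _ _ Yy)) ay cy; by [left|right].
- move=> E s bE ME LE.
  have [k kP] : exists k, forall a c j, a < E -> c < E -> j = ⟪a, c⟫ -> j < k.
    apply: bounded_collection2 => a c _ _.
    by exists ⟪a, c⟫.+1 => j ->.
  have [N NP] : exists N, forall a b q, a < E -> b < E -> link M ⟪a, b⟫ q -> q < N.
    by apply: bounded_collection2 => a b _ _; apply: matching_bounded.
  have [Ykinf aYk] := Yinf k.
  exists (tail (s + N + E) (Y k)); split.
  + split; [exact: unbounded_tail|exact: avoiding_tail|move=> y [Yy yN]].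
    have noN a b c : fs E a -> fs E b -> ~~ link M ⟪a, b⟫ ⟪c, y⟫.
      move=> /bit_lt aE /bit_lt bE'; apply/negP => /(NP _ _ _ aE bE').
      by have := leq_pair c y; lia.
    have old a b : (fs E `|` [set y]) a -> a < b -> fs E b -> fs E a.
      by move=> [//|->] yb /bit_lt; lia.
    move=> a b c d Ga [Eb|->] Gc [Ed|->] ab cd.
    * by apply: ME => //; [exact: old ab Eb|exact: old cd Ed].
    * by apply: noN => //; exact: old ab Eb.
    * by rewrite link_sym; apply: noN => //; exact: old cd Ed.
    * have [Ea|ay] := Ga; last by move: ab; rewrite ay ltnn.
      have [Ec|cy] := Gc; last by move: cd; rewrite cy ltnn.
      apply/negP => acy; have := LE a c Ea Ec.
      have ack := kP a c _ (bit_lt Ea) (bit_lt Ec) erefl.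
      by have /LlimP-> := (limP _ _ _ _ ack Yy).2 acy.
  + by move=> y [/YX].
  + by move=> y [_]; lia.
Qed.

(** Leaving out the finitely many partners of the points of [fs u], the
    condition can be extended by an arbitrarily large point. *)
Lemma admissible_grow Z M u X N : matching M -> admissible Z M u X ->
  exists u' X', [/\ admissible Z M u' X', between u X (fs u'), X' `<=` X &
    exists2 k, fs u' k & N <= k].
Proof.
move=> mM uX; have [L [mL LM Lu Lext]] := limit_matching mM uX.
have [m mP] : exists m, forall a x, a < u -> link L ⟪a, a⟫ ⟪x, x⟫ -> x < m.
  apply: (@bounded_collection (fun a x => link L ⟪a, a⟫ ⟪x, x⟫)) => a _.
  have [m mP] := matching_bounded ⟪a, a⟫ mL; exists m => x /mP.
  by have := leq_pair x x; lia.
have [Xinf aX MX] := uX; have [x Xx] := Xinf (m + N); move=> xmN.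
have [j|E [_ EE]] := @fs_exists (u + x).+1 (fs u `|` [set x]).
  by move=> [/bit_lt|->]; lia.
have bE : between u X (fs E).
  by rewrite EE; split=> j; [left|move=> [|->]; [left|right]].
have [||Y [EY YX _]] := Lext E 0 bE.
- by rewrite EE; apply: MX.
- have Lx a : fs u a -> ~~ link L ⟪a, a⟫ ⟪x, x⟫.
    by move=> /bit_lt au; apply/negP => /(mP _ _ au); lia.
  rewrite EE => a c [ua|->] [uc|->]; [exact: Lu|exact: Lx|by rewrite link_sym; exact: Lx|].
  by rewrite /link eqxx.
exists E, Y; split=> //; exists x; first by rewrite EE; right.
by lia.
Qed.

Definition pair_freeb (A : set nat) (E : nat) : bool :=
  all (fun a => all (fun b => all (fun c => all (fun d =>
    [&& bit E a, bit E b, bit E c, bit E d, a < b & c < d] ==>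
    ~~ link A ⟪a, b⟫ ⟪c, d⟫)
  (iota 0 E)) (iota 0 E)) (iota 0 E)) (iota 0 E).

Definition point_freeb (A : set nat) (E : nat) : bool :=
  all (fun a => all (fun c => (bit E a && bit E c) ==>
    ~~ link A ⟪a, a⟫ ⟪c, c⟫) (iota 0 E)) (iota 0 E).

Lemma pair_freeP A E : pair_freeb A E <-> pair_free A (fs E).
Proof.
split=> [AE a b c d Ea Eb Ec Ed ab cd|AE].
  have mE k : fs E k -> k \in iota 0 E by rewrite mem_iota => /bit_lt.
  move/allP/(_ _ (mE _ Ea))/allP/(_ _ (mE _ Eb))/allP/(_ _ (mE _ Ec)): AE.
  move=> /allP/(_ _ (mE _ Ed))/implyP; apply.
  by rewrite ab cd (Ea : bit _ _) (Eb : bit _ _) (Ec : bit _ _) (Ed : bit _ _).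
apply/allP => a _; apply/allP => b _; apply/allP => c _; apply/allP => d _.
by apply/implyP => /and5P[? ? ? ? /andP[? ?]]; apply: AE.
Qed.

Lemma point_freeP A E : point_freeb A E <-> point_free A (fs E).
Proof.
split=> [AE a c Ea Ec|AE].
  have mE k : fs E k -> k \in iota 0 E by rewrite mem_iota => /bit_lt.
  move/allP/(_ _ (mE _ Ea))/allP/(_ _ (mE _ Ec))/implyP: AE; apply.
  by rewrite (Ea : bit _ _) (Ec : bit _ _).
apply/allP => a _; apply/allP => c _.
by apply/implyP => /andP[? ?]; apply: AE.
Qed.

(** Sets outside the intended class count as supporting every answer.  This is
    what makes the relation enumerable, and when the relation fails, the set
    is known to lie in the class. *)
Definition answers (Z : set nat) (K : set nat -> Prop) (u : nat) (X : set nat)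
    (c : code) (A : set nat) (x : nat) : Prop :=
  [\/ ~ K A, ~ matching A, ~ (forall y, X y -> pair_free A (fs u `|` [set y])) |
   ~ point_free A (fs u) \/ exists E, betweenb u (fun k => k \in X) E &&
       (pair_freeb A E && point_freeb A E) /\
     eval (turing_join (fs E) Z) c (pi1 x) (pi2 x)].

Lemma enumerable_answers Z K u X c :
  enumerable (turing_join^~ (turing_join X Z)) (fun A _ => ~ K A) ->
  enumerable (turing_join^~ (turing_join X Z)) (answers Z K u X c).
Proof.
set O := turing_join^~ _ => Kenum.
have Xc : uniformly_below O (fun=> X).
  apply: uniformly_below_trans (reducible_joinl X Z) _.
  exact: uniformly_below_joinr.
have Zc : uniformly_below O (fun=> Z).
  apply: uniformly_below_trans (reducible_joinr X Z) _.
  exact: uniformly_below_joinr.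
have Ac : uniformly_below O id by apply: uniformly_below_joinl.
have linkc e k : computable O e -> computable O k ->
    recursive O (fun A x => link A (e A x) (k A x)).
  exact: (recursive_link Ac).
have pfc e : computable O e -> recursive O (fun A x => pair_freeb A (e A x)).
  by move=> ec; rewrite /pair_freeb; computability.
have ptc e : computable O e -> recursive O (fun A x => point_freeb A (e A x)).
  by move=> ec; rewrite /point_freeb; computability.
have matchc : enumerable O (fun A _ => ~ matching A).
  apply: enumerable_ext (@enumerable_search _ O (fun A m =>
    [&& link A (pi1 m) (pi1 (pi2 m)), link A (pi1 m) (pi2 (pi2 m)) &
        pi1 (pi2 m) != pi2 (pi2 m)]) _); last by computability.
  move=> A _; split=> [[m /and3P[l1 l2 /eqP ne]] /(_ _ _ _ l1 l2)//|nm].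
  apply: contrapT => nex; apply: nm => p q r pq pr; apply/eqP/negP => qr.
  by apply: nex; exists ⟪p, ⟪q, r⟫⟫; rewrite !(pairK1, pairK2) pq pr; apply/negP.
have oldc : enumerable O (fun A _ =>
    ~ (forall y, X y -> pair_free A (fs u `|` [set y]))).
  apply: enumerable_ext (@enumerable_search _ O (fun A m =>
    [&& pi1 m \in X, betweenb u (fun k => k == pi1 m) (pi2 m) &
        ~~ pair_freeb A (pi2 m)]) _); last first.
    apply: recursive_and; first by computability.
    apply: recursive_and; last by apply: recursive_negb; apply: pfc; computability.
    apply: (@recursive_between _ _ u (fun _ z => pi2 (pi2 z))
      (fun _ z k => k == pi1 (pi2 z))); by computability.
  have bP m E : betweenb u (fun k => k == m) E <-> between u [set m] (fs E).
    by apply: betweenP => k; split=> /eqP.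
  move=> A _; split=> [[m /and3P[/set_mem Xm /bP [_ bE] /negP nE]] H|nH].
    by apply/nE/pair_freeP; apply: pair_free_sub bE _; apply: H.
  apply: contrapT => nex; apply: nH => y Xy.
  have [j|E [_ EE]] := @fs_exists (u + y).+1 (fs u `|` [set y]).
    by move=> [/bit_lt|->]; lia.
  rewrite -EE; apply/pair_freeP; apply/negPn/negP => nE; apply: nex.
  exists ⟪y, E⟫; rewrite pairK1 pairK2 mem_set // nE andbT.
  by apply/bP; rewrite EE; split=> // k; left.
have pointc : enumerable O (fun A _ => ~ point_free A (fs u)).
  apply: enumerable_ext (@enumerable_recursive _ O (fun A _ => ~~ point_freeb A u) _).
    by move=> A _; rewrite -point_freeP; split=> [/negP|/negP].
  by apply: recursive_negb; apply: ptc; computability.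
have ansc : enumerable O (fun A x =>
    exists E, betweenb u (fun k => k \in X) E &&
       (pair_freeb A E && point_freeb A E) /\
     eval (turing_join (fs E) Z) c (pi1 x) (pi2 x)).
  apply: enumerable_ex; apply: enumerable_and.
    apply: recursive_and; last first.
      by apply: recursive_and; [apply: pfc|apply: ptc]; computability.
    apply: (@recursive_between _ _ u (fun _ => pi2) (fun _ _ k => k \in X)).
      by computability.
    by apply: (recursive_mem Xc); computability.
  apply: (@enumerable_eval _ _ (fun _ E => turing_join (fs E) Z) c
    (fun _ z => pi2 z)); try by computability.
  move=> e k ec kc; apply: recursive_join => //.
    by apply: recursive_in_fs; computability.
  by apply: (recursive_mem Zc); computability.
apply: enumerable_ext (enumerable_or Kenum (enumerable_or matchc
  (enumerable_or oldc (enumerable_or pointc ansc)))).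
move=> A x; split=> [[?|[?|[?|?]]]|[?|?|?|?]].
- exact: Or41.
- exact: Or42.
- exact: Or43.
- exact: Or44.
- by left.
- by right; left.
- by right; right; left.
- by right; right; right.
Qed.

Lemma answersP Z K u X c A n i : answers Z K u X c A ⟪n, i⟫ <->
  [\/ ~ K A, ~ matching A, ~ (forall y, X y -> pair_free A (fs u `|` [set y])) |
   ~ point_free A (fs u) \/ exists E, [/\ between u X (fs E),
     pair_free A (fs E), point_free A (fs E) & eval (turing_join (fs E) Z) c n i]].
Proof.
rewrite /answers pairK1 pairK2.
have bP E : betweenb u (fun k => k \in X) E <-> between u X (fs E).
  by apply: betweenP => k; split=> [/set_mem|/mem_set].
suff -> : (exists E, betweenb u (fun k => k \in X) E &&
       (pair_freeb A E && point_freeb A E) /\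
     eval (turing_join (fs E) Z) c n i) = exists E, [/\ between u X (fs E),
     pair_free A (fs E), point_free A (fs E) & eval (turing_join (fs E) Z) c n i] by [].
apply/propext; split=> -[E].
  by move=> [/and3P[/bP ? /pair_freeP ? /point_freeP ?] ?]; exists E.
by move=> [/bP bE /pair_freeP pE /point_freeP qE ev]; exists E; rewrite bE pE qE.
Qed.

(** The forcing construction common to [rainbow_below] and [rainbow_avoiding].
    The question ranges over the matchings in a class [K] that contains every
    possible limit of [M].  A wrong answer for the limit matching yields a
    decisive finite extension.  Otherwise a cone avoiding [A] misses the right
    answer, and the fourth hypothesis provides a reservoir on which [M]-free
    sets are also [A]-free. *)
Lemma rainbow_forcing Z M (K : set nat -> Prop) : matching M ->
  (forall A, same_pairs A M -> K A) ->
  (forall X, enumerable (turing_join^~ (turing_join X Z)) (fun A _ => ~ K A)) ->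
  (forall u X A, admissible Z M u X -> K A -> matching A ->
    point_free A (fs u) -> (forall x, X x -> pair_free A (fs u `|` [set x])) ->
    ~ turing_reducible W (turing_join A (turing_join X Z)) ->
    exists Y, [/\ unbounded Y, avoiding W Z Y, Y `<=` fs u `|` X &
      forall E, between u Y (fs E) -> pair_free M (fs E) ->
        pair_free A (fs E) /\ point_free A (fs E)]) ->
  forall u X, admissible Z M u X ->
    exists G, [/\ unbounded G, avoiding W Z G, between u X G & pair_free M G].
Proof.
move=> mM KM Kenum solver u0 X0 uX0.
have admfree u X : admissible Z M u X -> pair_free M (fs u).
  move=> [Xinf _ MX]; have [x Xx _] := Xinf 0.
  by apply: pair_free_sub (MX x Xx) => k; left.
have [u X uX|c u X uX|N u X uX|G [Ginf aG bG MG]] :=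
  @mathias_generic W Z (admissible Z M) (pair_free M) u0 X0 uX0.
- by move=> E Eu; apply: pair_free_sub Eu _; apply: admfree uX.
- have [Xinf aX MX] := uX.
  have [[n Vn]|[n [A [nV aA]]]] :=
      forcing_question aX (enumerable_answers u c (Kenum X)).
    have [L [mL LM Lu Lext]] := limit_matching mM uX.
    have nW : (n \notin W : nat) != (n \in W) by case: (n \in W).
    have /answersP[nK|//|nold|[//|[E [bE LE LEp ev]]]] := Vn L.
    + by case: nK; apply: KM.
    + case: nold => y Xy; apply: same_pairs_free (MX y Xy).
      by move=> a b c' d ab cd; rewrite LM.
    + have [s sP] := forces_wrong (pair_free M) ev nW.
      have [Y [EY YX sY]] := Lext E s bE (same_pairs_free LM LE) LEp.
      exists E, Y; split=> //; last exact: sP.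
      by move=> y /YX; right.
  have nA := fun H => nV ((answersP _ _ _ _ _ _ _ _).2 H).
  have KA : K A by apply: contrapT => ?; apply: nA; apply: Or41.
  have mA : matching A by apply: contrapT => ?; apply: nA; apply: Or42.
  have oldA : forall y, X y -> pair_free A (fs u `|` [set y]).
    by apply: contrapT => ?; apply: nA; apply: Or43.
  have uA : point_free A (fs u) by apply: contrapT => ?; apply: nA; apply: Or44; left.
  have [Y [Yinf aY YX MA]] := solver u X A uX KA mA uA oldA aA.
  exists u, Y; split=> //.
  + split=> // x /YX[ux|/MX//].
    by apply: pair_free_sub (admfree u X uX) => k [//|->].
  + by split=> k //; left.
  + apply: (forces_miss (n := n)) => E ME bE ev; apply: nA; apply: Or44; right.
    have [AE AEp] := MA E bE ME; exists E; split=> //.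
    by case: bE => uE EY; split=> // k /EY[|/YX//]; left.
- have [u' [X' [? ? X'X ?]]] := admissible_grow N mM uX.
  by exists u', X'; split=> // x /X'X; right.
exists G; split=> // a b c d Ga Gb Gc Gd ab cd.
have [k|E [_ EE]] := @fs_exists (b + d).+1 [set k | k = a \/ k = b \/ k = c \/ k = d].
  by move=> [|[|[|]]] ->; lia.
apply: (MG E); rewrite ?EE //=; try tauto.
by move=> k [|[|[|]]] ->.
Qed.

(** A matching below [Z]: the question only ranges over the possible limits. *)
Lemma rainbow_below Z M u X : matching M -> turing_reducible M Z ->
  admissible Z M u X ->
  exists G, [/\ unbounded G, avoiding W Z G, between u X G & pair_free M G].
Proof.
move=> mM MZ; apply: (rainbow_forcing (K := same_pairs^~ M)) => // {u X} [X|u X A].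
  set O := turing_join^~ _.
  have Mc : uniformly_below O (fun=> M).
    apply: uniformly_below_trans (turing_trans MZ (reducible_joinr X Z)) _.
    exact: uniformly_below_joinr.
  have Ac : uniformly_below O id by apply: uniformly_below_joinl.
  have lA e k : computable O e -> computable O k ->
    recursive O (fun A x => link A (e A x) (k A x)) by exact: (recursive_link Ac).
  have lM e k : computable O e -> computable O k ->
    recursive O (fun A x => link M (e A x) (k A x)) by exact: (recursive_link Mc).
  apply: enumerable_ext (@enumerable_search _ O (fun A m =>
    [&& pi1 (pi1 m) < pi2 (pi1 m), pi1 (pi2 m) < pi2 (pi2 m) &
      (link A (pi1 m) (pi2 m) && ~~ link M (pi1 m) (pi2 m)) ||
      (~~ link A (pi1 m) (pi2 m) && link M (pi1 m) (pi2 m))]) _); last first.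
    by computability.
  move=> A _; split=> [[m /and3P[m1 m2 ne]] sAM|nAM].
    by have := sAM _ _ _ _ m1 m2; rewrite !pairE => E; move: ne; rewrite E; case: link.
  apply: contrapT => nex; apply: nAM => a b c d ab cd; apply/eqP/negP => ne.
  apply: nex; exists ⟪⟪a, b⟫, ⟪c, d⟫⟫; rewrite !(pairK1, pairK2) ab cd /=.
  by move: ne; case: link; case: link.
move=> [Xinf aX MX] AM mA Au _ aA.
have XY : turing_reducible X (turing_join A (turing_join X Z)).
  exact: turing_trans (reducible_joinl X Z) (reducible_joinr _ _).
have ZY : turing_reducible Z (turing_join A (turing_join X Z)).
  exact: turing_trans (reducible_joinr X Z) (reducible_joinr _ _).
have [Y [Yinf YX Yr AY]] := point_free_thinning mA Xinf Au (reducible_joinl A _) XY.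
exists Y; split=> //; first exact: avoiding_below aA Yr ZY.
  by move=> x /YX; right.
move=> E [_ EY] ME; split; last exact: point_free_sub AY.
by apply: same_pairs_free ME => a b c d ab cd; rewrite AM.
Qed.

(** An arbitrary matching: the question ranges over all matchings, and a
    matching that misses the right answer is itself below the new oracle. *)
Lemma rainbow_avoiding Z M u X : matching M -> admissible Z M u X ->
  exists G, [/\ unbounded G, avoiding W Z G, between u X G & pair_free M G].
Proof.
move=> mM; apply: (rainbow_forcing (K := fun=> True)) => // {u X} [X|u X A].
  apply: enumerable_ext (@enumerable_search _ _ (fun _ _ => false) _).
    by move=> A _; split=> [[]|].
  exact: computable_cst.
move=> [Xinf aX MX] _ mA Au oldA aA; set Y := turing_join A _ in aA.
have XY : turing_reducible X Y.
  exact: turing_trans (reducible_joinl X Z) (reducible_joinr _ _).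
have ZY : turing_reducible Z Y.
  exact: turing_trans (reducible_joinr X Z) (reducible_joinr _ _).
have [V [Vinf VX VY AV]] := point_free_thinning mA Xinf Au (reducible_joinl A _) XY.
have [||G [Ginf aG [uG GV] AG]] := @rainbow_below Y A u V mA.
- exact: reducible_joinl.
- split=> //; last by move=> x /VX; apply: oldA.
  exact: avoiding_below aA VY (turing_refl Y).
exists G; split=> //.
- apply: avoiding_below aG (reducible_joinl _ _) _.
  exact: turing_trans ZY (reducible_joinr _ _).
- by move=> x /GV[|/VX]; [left|right].
- move=> E [_ EG] _.
  have EG' : fs E `<=` G by move=> x /EG[/uG|].
  split; first exact: pair_free_sub AG.
  by apply: point_free_sub AV; exact: subset_trans GV.
Qed.

End Rainbow.

Lemma unbounded_infinite X : unbounded X -> infinite_set X.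
Proof.
move=> Xinf /finite_seqP[s Xs]; have [x Xx] := Xinf (\max_(i <- s) i).+1.
have xs : x \in s by move: Xx; rewrite Xs.
by rewrite ltnNge (@leq_bigmax_seq _ s xpredT id).
Qed.

Theorem theorem2p1 (W Z : set nat) (hW : ~ turing_reducible W Z)
    (f : nat * nat -> nat) (hf : two_bounded f) :
  exists H : set nat,
    [/\ infinite_set H, rainbow f H &
        ~ turing_reducible W (turing_join H Z)].
Proof.
pose pairs p := increasing_pairs setT (Cantor.of_nat p).
pose M : set nat := [set z | [/\ pairs (pi1 z), pairs (pi2 z) &
  f (Cantor.of_nat (pi1 z)) = f (Cantor.of_nat (pi2 z))]].
have linkM p q : link M p q <-> [/\ p <> q, pairs p, pairs q &
    f (Cantor.of_nat p) = f (Cantor.of_nat q)].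
  rewrite /link; split=> [/andP[/eqP pq /orP[]/set_mem]|[/eqP-> ? ? ?]] /=.
  - by rewrite /M /= pairK1 pairK2 => -[? ? ?].
  - by rewrite /M /= pairK1 pairK2 => -[? ? ->].
  - by apply/orP; left; apply/mem_set; rewrite /M /= pairK1 pairK2.
have mM : matching M.
  move=> p q r /linkM[pq ppairs qpairs fpq] /linkM[pr _ rpairs fpr].
  have /pcard_leP[g] := hf (f (Cantor.of_nat p)).
  set A := (X in {injfun X >-> _}) in g.
  have Ap : A (Cantor.of_nat p) by split.
  have Aq : A (Cantor.of_nat q) by split.
  have Ar : A (Cantor.of_nat r) by split.
  have ginj x y : A (Cantor.of_nat x) -> A (Cantor.of_nat y) ->
      g (Cantor.of_nat x) = g (Cantor.of_nat y) -> x = y.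
    move=> Ax Ay /(inj (mem_set Ax) (mem_set Ay)) E.
    by rewrite -[x]Cantor.cancel_to_of E Cantor.cancel_to_of.
  have g2 x : A x -> g x < 2 by move=> Ax; exact: (@funS _ _ _ _ g).
  have [] : [\/ g (Cantor.of_nat p) = g (Cantor.of_nat q),
      g (Cantor.of_nat p) = g (Cantor.of_nat r) |
      g (Cantor.of_nat q) = g (Cantor.of_nat r)].
  - move: (g2 _ Ap) (g2 _ Aq) (g2 _ Ar).
    case: (g _) => [|[|?]]; case: (g _) => [|[|?]]; case: (g _) => [|[|?]] // _ _ _;
      by [apply: Or31|apply: Or32|apply: Or33].
  - by move/ginj => /(_ Ap Aq)/pq.
  - by move/ginj => /(_ Ap Ar)/pr.
  - by move/ginj; apply.
have adm : admissible W Z M 0 setT.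
  split.
  - by move=> N; exists N.
  - apply: avoiding_below hW _ (turing_refl Z).
    by apply: (reducible_recursive (P := fun=> true)) => //; apply: (computable_cst _ 1).
  - move=> x _ a b c d [/bit_lt//|->] [/bit_lt//|->].
    by rewrite ltnn.
have [G [Ginf aG _ MG]] := rainbow_avoiding mM adm.
exists G; split=> //; first exact: unbounded_infinite.
move=> [a b] [c d] /set_mem[/= Ga Gb ab] /set_mem[/= Gc Gd cd] fE.
apply: contrapT => ne; apply: (negP (MG a b c d Ga Gb Gc Gd ab cd)).
apply/linkM; rewrite /pairs !Cantor.cancel_of_to; split=> //.
by move=> /Cantor.to_nat_inj.
Qed.
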